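(* Let $M$ be a smooth manifold. The assignment $(\vartheta,\nabla)\mapsto(\vartheta^{-1},\nabla)$ gives a bijection between non-degenerate symmetric Poisson structures on $M$ and non-degenerate Killing $2$-tensors on $M$ with the attached connection, i.e. pairs $(K,\nabla)$ where $\nabla$ is a torsion-free connection on $M$ and $K\in\Gamma(\mathrm{Sym}^2T^*M)$ is non-degenerate and a Killing tensor for $\nabla$.
   Context: A symmetric bivector field $\vartheta\in\Gamma(\mathrm{Sym}^2TM)$ is viewed as a map $T^*M\to TM$, $\beta(\vartheta(\alpha))=\vartheta(\alpha,\beta)$; it is non-degenerate if this map is an isomorphism, and then $\vartheta^{-1}:TM\to T^*M$ is regarded as a non-degenerate symmetric $2$-form. For a connection $\nabla$ and vector fields put $[X,Y]_s:=\nabla_XY+\nabla_YX$; the symmetric Schouten bracket is the unique $\mathbb{R}$-bilinear commutative map $[\cdot,\cdot]_s$ on $\bigoplus_r\Gamma(\mathrm{Sym}^rTM)$ extending it, with $[X,f]_s=Xf$, and such that for $\mathcal{X}$ of degree $r$, $[\mathcal{X},\cdot]_s$ is a degree-$(r-1)$ derivation of the symmetric product $\odot$ (normalized by $X\odot Y=X\otimes Y+Y\otimes X$). A symmetric Poisson structure is a pair $(\vartheta,\nabla)$ of a symmetric bivector field and a torsion-free connection with $[\vartheta,\vartheta]_s=0$; it is non-degenerate if $\vartheta$ is. A symmetric $r$-form $K\in\Gamma(\mathrm{Sym}^rT^*M)$ is a Killing $r$-tensor for $\nabla$ if its symmetric derivative $\nabla^sK:=(r+1)\,\mathrm{sym}(\nabla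 K)$ vanishes, where $\mathrm{sym}$ is the symmetric projection. For $r=2$ this means $(\nabla_XK)(Y,Z)+(\nabla_YK)(Z,X)+(\nabla_ZK)(X,Y)=0$ for all vector fields $X,Y,Z$. *)

(* Defs.v *)
From HB Require Import structures.
From mathcomp Require Import all_boot all_order all_algebra.
From mathcomp Require Import all_classical all_reals all_analysis.
From mathcomp Require Import ring.
Set Implicit Arguments.
Unset Strict Implicit.
Unset Printing Implicit Defensive.
Import Order.TTheory GRing.Theory Num.Theory.
Import numFieldNormedType.Exports.
Local Open Scope classical_set_scope.
Local Open Scope ring_scope.

(* Conventions.  M is a Hausdorff, second countable manifold of pure dimension
   n, given by a smooth atlas.  Tensor fields are taken in their C^oo(M)-linear
   form: vector fields are the R-linear derivations of C^oo(M), 1-forms are the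
   C^oo(M)-linear maps from vector fields to C^oo(M), and sections of Sym^r TM
   (resp. Sym^r T^*M) are the symmetric C^oo(M)-multilinear functions of r
   1-forms (resp. of r vector fields). *)

Section Smooth.
Context {R : realType} {n : nat}.
Implicit Types (U : set 'rV[R]_n) (f g : 'rV[R]_n -> R).

Fixpoint Ck (k : nat) U f : Prop :=
  if k is k'.+1 then
    (forall x, U x -> differentiable f x) /\
    (forall v, Ck k' U (fun x => 'D_v f x))
  else forall x, U x -> {for x, continuous f}.

Definition smooth_on U f := forall k, Ck k U f.

Lemma near_eq_differentiable f g x :
  (\forall y \near x, f y = g y) -> differentiable f x -> differentiable g x.
Proof.
move=> fg df.
pose h := g - f.
have hx : \forall y \near x, h y = 0.
  by near=> y; rewrite /h /= !fctE (near fg y) // subrr.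
have h0 : h x = 0 by exact: nbhs_singleton hx.
have oh : h \o shift x = cst (h x) + (\0 : 'rV[R]_n -> R) +o_ 0 id.
  apply/eqaddoP => e e0.
  have hx' := hx; rewrite (near_shift 0) subr0 in hx'.
  near=> y; have hy : (h \o shift x) y = 0 by near: y.
  rewrite [X in `|X|](_ : _ = (h \o shift x) y - (h x + 0)) //.
  by rewrite hy h0 addr0 subrr normr0 mulr_ge0 // ltW.
have c0 : continuous (\0 : 'rV[R]_n -> R) by exact: cst_continuous.
have dh0 : 'd h x = \0 :> ('rV[R]_n -> R) by exact: diff_unique.
have dh : differentiable h x by apply/diff_locallyP; rewrite dh0.
have -> : g = f + h by rewrite /h addrC subrK.
exact: differentiableD.
Unshelve. all: by end_near. Qed.

Lemma eq_Ck k U f g : open U -> (forall x, U x -> f x = g x) ->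
  Ck k U f -> Ck k U g.
Proof.
move=> oU; elim: k f g => [|k IH] f g fg.
  move=> cf x Ux.
  have fgx : \forall y \near x, f y = g y.
    by apply: filterS fg _; exact: open_nbhs_nbhs.
  rewrite /prop_for /continuous_at -(fg _ Ux).
  exact: cvg_trans (near_eq_cvg fgx) (cf x Ux).
have fgx x : U x -> \forall y \near x, f y = g y.
  by move=> Ux; apply: filterS fg _; exact: open_nbhs_nbhs.
move=> [df Df]; split=> [x Ux|v].
  by apply: near_eq_differentiable (df x Ux); exact: fgx.
by apply: IH (Df v) => x Ux; apply: near_eq_derive; exact: fgx.
Qed.

Lemma CkS k U f : Ck k.+1 U f -> Ck k U f.
Proof.
elim: k f => [|k IH] f [df Df].
  by move=> x Ux; apply: differentiable_continuous; exact: df.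
by split=> // v; apply: IH; exact: Df.
Qed.

Lemma Ck_cst k U c : open U -> Ck k U (cst c).
Proof.
move=> oU; elim: k c => [|k IH] c /=; first by move=> x _; exact: cst_continuous.
split=> [x _|v]; first exact: differentiable_cst.
by apply: eq_Ck (IH 0) => // x _; rewrite derive_cst.
Qed.

Lemma CkD k U f g : open U -> Ck k U f -> Ck k U g -> Ck k U (f + g).
Proof.
move=> oU; elim: k f g => [|k IH] f g /=.
  by move=> cf cg x Ux; apply: continuousD; [exact: cf|exact: cg].
move=> [df Df] [dg Dg]; split=> [x Ux|v].
  by apply: differentiableD; [exact: df|exact: dg].
apply: eq_Ck (IH _ _ (Df v) (Dg v)) => // x Ux.
by rewrite deriveD //; apply: diff_derivable; [exact: df|exact: dg].
Qed.

Lemma CkM k U f g : open U -> Ck k U f -> Ck k U g -> Ck k U (f * g).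
Proof.
move=> oU; elim: k f g => [|k IH] f g.
  by move=> cf cg x Ux; apply: continuousM; [exact: cf|exact: cg].
move=> Cf Cg; have [df Df] := Cf; have [dg Dg] := Cg.
split=> [x Ux|v].
  by apply: differentiableM; [exact: df|exact: dg].
apply: eq_Ck (CkD oU (IH _ _ (CkS Cf) (Dg v)) (IH _ _ (CkS Cg) (Df v))) => //.
move=> x Ux.
by rewrite deriveM //; apply: diff_derivable; [exact: df|exact: dg].
Qed.

End Smooth.

Section Manifold.
Context (R : realType) (n : nat).

(* chart_inv is only meaningful on chart_map @` chart_dom *)
Record chart (M : topologicalType) := Chart {
  chart_dom : set M;
  chart_map :> M -> 'rV[R]_n;
  chart_inv : 'rV[R]_n -> M;
  chart_dom_open : open chart_dom;
  chart_img_open : open (chart_map @` chart_dom);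
  chart_mapK : forall x, chart_dom x -> chart_inv (chart_map x) = x;
  chart_map_cont : forall x, chart_dom x -> {for x, continuous chart_map};
  chart_inv_cont : forall y, (chart_map @` chart_dom) y ->
    {for y, continuous chart_inv} }.

Definition compatible (M : topologicalType) (c d : chart M) :=
  forall j : 'I_n, smooth_on (c @` (chart_dom c `&` chart_dom d))
                             (fun y => d (chart_inv c y) 0 j).

Record smoothManifold := SmoothManifold {
  carrier :> topologicalType;
  atlas : set (chart carrier);
  manifold_hausdorff : hausdorff_space carrier;
  manifold_second_countable : @second_countable carrier;
  atlas_cover : forall x : carrier, exists2 c, atlas c & chart_dom c x;
  atlas_compatible : forall c d, atlas c -> atlas d -> compatible c d }.

End Manifold.

Section SmoothFunctions.
Context (R : realType) (n : nat) (M : smoothManifold R n).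

Definition is_smooth (f : M -> R) :=
  forall c, atlas c -> smooth_on (c @` chart_dom c) (f \o chart_inv c).

Definition smooth_pred : {pred M -> R} := fun f => `[< is_smooth f >].

Lemma smooth_cst c : cst c \in smooth_pred.
Proof. by apply/asboolP => d _ k; apply: Ck_cst; exact: chart_img_open. Qed.

Lemma smooth_subring_closed : subring_closed smooth_pred.
Proof.
split; first exact: smooth_cst.
- move=> f g /asboolP sf /asboolP sg; apply/asboolP => c ac k.
  have oU := @chart_img_open _ _ _ c.
  have -> : (f - g) \o chart_inv c =
            (f \o chart_inv c) + (cst (- 1) * (g \o chart_inv c)).
    by rewrite funeqE => y; rewrite !fctE/= mulN1r.
  by apply: CkD => //; [exact: sf|apply: CkM; [|exact: Ck_cst|exact: sg]].
- move=> f g /asboolP sf /asboolP sg; apply/asboolP => c ac k.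
  by apply: (@CkM _ _ _ _ (f \o chart_inv c) (g \o chart_inv c));
    [exact: chart_img_open|exact: sf|exact: sg].
Qed.

HB.instance Definition _ :=
  GRing.isSubringClosed.Build (M -> R) smooth_pred smooth_subring_closed.

Record cinf := Cinf { cinf_fun :> M -> R; _ : cinf_fun \in smooth_pred }.
HB.instance Definition _ := [isSub for cinf_fun].
HB.instance Definition _ := [Choice of cinf by <:].
HB.instance Definition _ := GRing.SubChoice_isSubComPzRing.Build
  (M -> R) smooth_pred cinf smooth_subring_closed.

Definition cinf_cst (c : R) : cinf := Cinf (smooth_cst c).

Definition is_derivation (X : cinf -> cinf^o) :=
  (forall (c : R) (f g : cinf),
      X (cinf_cst c * f + g) = cinf_cst c * X f + X g) /\
  (forall f g : cinf, X (f * g) = f * X g + g * X f).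

Definition derivation_pred : {pred cinf -> cinf^o} :=
  fun X => `[< is_derivation X >].

Lemma derivation_submod_closed : submod_closed derivation_pred.
Proof.
split.
  by apply/asboolP; split=> [c f g|f g]; rewrite /= ?mulr0 addr0.
move=> h X Y /asboolP[XD XM] /asboolP[YD YM]; apply/asboolP.
have e1 (c x x' y y' : cinf) :
  h * (c * x + x') + (c * y + y') = c * (h * x + y) + (h * x' + y') by ring.
have e2 (f g x x' y y' : cinf) : h * (f * x + g * x') + (f * y + g * y') =
  f * (h * x + y) + g * (h * x' + y') by ring.
split=> [c f g|f g].
- by have := e1 (cinf_cst c) (X f) (X g) (Y f) (Y g); rewrite -XD -YD.
- by have := e2 f g (X g) (X f) (Y g) (Y f); rewrite -XM -YM.
Qed.

HB.instance Definition _ := GRing.isSubmodClosed.Build cinf (cinf -> cinf^o)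
  derivation_pred derivation_submod_closed.

Record vfield := VField {
  vfield_fun :> cinf -> cinf^o; _ : vfield_fun \in derivation_pred }.
HB.instance Definition _ := [isSub for vfield_fun].
HB.instance Definition _ := [Choice of vfield by <:].
HB.instance Definition _ := [SubChoice_isSubLmodule of vfield by <:].

Lemma vfieldP (X : vfield) : is_derivation X.
Proof. by apply/asboolP; exact: (valP X). Qed.

Lemma lie_subproof (X Y : vfield) :
  (fun f => X (Y f) - Y (X f)) \in derivation_pred.
Proof.
have [XD XM] := vfieldP X; have [YD YM] := vfieldP Y.
have XA f g : X (f + g) = X f + X g.
  by have := XD 1 f g; rewrite (_ : cinf_cst 1 = 1) ?mul1r//; exact: val_inj.
have YA f g : Y (f + g) = Y f + Y g.
  by have := YD 1 f g; rewrite (_ : cinf_cst 1 = 1) ?mul1r//; exact: val_inj.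
have e1 (c x x' y y' : cinf) :
  (c * x + x') - (c * y + y') = c * (x - y) + (x' - y') by ring.
have e2 (f g x x' xg xf y y' yg yf : cinf) :
  (f * x + yg * xf + (g * x' + yf * xg)) -
  (f * y + xg * yf + (g * y' + xf * yg)) = f * (x - y) + g * (x' - y') by ring.
apply/asboolP; split=> [c f g|f g]; rewrite ?XD ?YD ?XD ?YD.
  exact: e1.
by rewrite XM YM XA YA !XM !YM; exact: e2.
Qed.
Definition lie (X Y : vfield) : vfield := VField (lie_subproof X Y).

Definition oneform_pred : {pred vfield -> cinf^o} :=
  fun a => `[< linear a >].

Lemma oneform_submod_closed : submod_closed oneform_pred.
Proof.
split.
  by apply/asboolP => f X Y; rewrite /= scaler0 addr0.
move=> h a b /asboolP al /asboolP bl; apply/asboolP => f X Y.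
rewrite /= ?fctE al bl.
have e (x x' y y' : cinf) :
  h * (f * x + x') + (f * y + y') = f * (h * x + y) + (h * x' + y') by ring.
exact: e.
Qed.

HB.instance Definition _ := GRing.isSubmodClosed.Build cinf (vfield -> cinf^o)
  oneform_pred oneform_submod_closed.

Record oneform := OneForm {
  oneform_fun :> vfield -> cinf^o; _ : oneform_fun \in oneform_pred }.
HB.instance Definition _ := [isSub for oneform_fun].
HB.instance Definition _ := [Choice of oneform by <:].
HB.instance Definition _ := [SubChoice_isSubLmodule of oneform by <:].

Lemma oneformP (a : oneform) : linear a.
Proof. by apply/asboolP; exact: (valP a). Qed.

End SmoothFunctions.
Arguments oneform_pred {R n} M _.

(* An element F of symt V is a finite sum of symmetric A-multilinear functions
   of r = 0, 1, 2, ... elements of V, the degree r component being the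
   restriction of F to the sequences of length r.  Linearity in the first
   argument suffices because of the symmetry. *)
Section SymmetricTensors.
Context {A : comPzRingType}.

Section Def.
Context (V : lmodType A).

Definition is_symt (F : seq V -> A^o) :=
  [/\ forall s t, perm_eq s t -> F s = F t,
      forall a u v s, F ((a *: u + v) :: s) = a * F (u :: s) + F (v :: s)
    & exists N, forall s, (N < size s)%N -> F s = 0].

Definition symt_pred : {pred seq V -> A^o} := fun F => `[< is_symt F >].

Lemma symt_submod_closed : submod_closed symt_pred.
Proof.
split.
  apply/asboolP; split=> //; last by exists 0%N.
  by move=> a u v s; rewrite /= mulr0 addr0.
move=> h F G /asboolP[Fs Fl [N FN]] /asboolP[Gs Gl [P GP]]; apply/asboolP.
split=> [s t st|a u v s|]; rewrite /= ?fctE.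
- by rewrite (Fs _ _ st) (Gs _ _ st).
- rewrite Fl Gl; have e (x x' y y' : A) :
    h * (a * x + x') + (a * y + y') = a * (h * x + y) + (h * x' + y') by ring.
  exact: e.
exists (maxn N P) => s; rewrite gtn_max => /andP[/FN Fs0 /GP Gs0].
by rewrite /= Fs0 Gs0 scaler0 addr0.
Qed.

HB.instance Definition _ := GRing.isSubmodClosed.Build A (seq V -> A^o)
  symt_pred symt_submod_closed.

Record symt := Symt { symt_fun :> seq V -> A^o; _ : symt_fun \in symt_pred }.
HB.instance Definition _ := [isSub for symt_fun].
HB.instance Definition _ := [Choice of symt by <:].
HB.instance Definition _ := [SubChoice_isSubLmodule of symt by <:].

Lemma symtP (F : symt) : is_symt F.
Proof. by apply/asboolP; exact: (valP F). Qed.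

End Def.
Arguments symt_pred V _ : clear implicits.

Context {V : lmodType A}.
Implicit Types F G : symt V.

Definition homog (r : nat) F := forall s, size s != r -> F s = 0.

(* all ways to split a sequence into two complementary subsequences *)
Fixpoint splits (T : Type) (s : seq T) : seq (seq T * seq T) :=
  if s is x :: s' then
    [seq (x :: p.1, p.2) | p <- splits s'] ++
    [seq (p.1, x :: p.2) | p <- splits s']
  else [:: ([::], [::])].

(* The symmetric product normalized by u (.) v = u (x) v + v (x) u, i.e.
   (F (.) G)(v_1, ..., v_(r+s)) =
     1 / (r! s!) \sum_(sigma in S_(r+s)) F(v_sigma(1), ...) G(..., v_sigma(r+s)),
   written as a sum over (r, s)-shuffles. *)
Definition symprod_fun F G (s : seq V) : A^o :=
  \sum_(p <- splits s) F p.1 * G p.2.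

Lemma sum_splits_cons (H : seq V -> seq V -> A) x s :
  \sum_(p <- splits (x :: s)) H p.1 p.2 =
  \sum_(p <- splits s) (H (x :: p.1) p.2 + H p.1 (x :: p.2)).
Proof. by rewrite /= big_cat !big_map big_split. Qed.

Lemma sum_splits_perm (H : seq V -> seq V -> A) s t :
  (forall a a' b b', perm_eq a a' -> perm_eq b b' -> H a b = H a' b') ->
  perm_eq s t ->
  \sum_(p <- splits s) H p.1 p.2 = \sum_(p <- splits t) H p.1 p.2.
Proof.
have mid x s1 s2 (H' : seq V -> seq V -> A) :
    (forall a a' b b', perm_eq a a' -> perm_eq b b' -> H' a b = H' a' b') ->
    \sum_(p <- splits (s1 ++ x :: s2)) H' p.1 p.2 =
    \sum_(p <- splits (x :: s1 ++ s2)) H' p.1 p.2.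
  elim: s1 H' => [//|y s1 IH] H' H'P; rewrite cat_cons !sum_splits_cons.
  rewrite (IH (fun a b => H' (y :: a) b + H' a (y :: b))).
    rewrite (sum_splits_cons (fun a b => H' (y :: a) b + H' a (y :: b))).
    rewrite cat_cons (sum_splits_cons (fun a b => H' (x :: a) b + H' a (x :: b))).
    apply: eq_bigr => p _; rewrite addrACA; congr (_ + _ + (_ + _));
      by apply: H'P => //; exact/permPl/(perm_catCA [:: y] [:: x]).
  by move=> a a' b b' aa bb; congr (_ + _); apply: H'P; rewrite ?perm_cons.
move=> HP; elim: s t H HP => [|x s IH] t H HP st.
  by have /perm_size/esym/size0nil -> := st.
have xt : x \in t by rewrite -(perm_mem st) mem_head.
case/splitPr: xt st => t1 t2 st; rewrite mid // !sum_splits_cons.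
apply: (IH _ (fun a b => H (x :: a) b + H a (x :: b))).
  by move=> a a' b b' aa bb; congr (_ + _); apply: HP; rewrite ?perm_cons.
by move: st; rewrite perm_sym perm_catC cat_cons perm_cons perm_catC perm_sym.
Qed.

Lemma size_splits (T : Type) (s : seq T) :
  all (fun n => n == size s) [seq (size p.1 + size p.2)%N | p <- splits s].
Proof.
elim: s => //= x s; rewrite map_cat all_cat !all_map => H; apply/andP.
by split; apply: sub_all H => p /=; rewrite ?addSn ?addnS eqSS.
Qed.

Lemma symprod_subproof F G : symprod_fun F G \in symt_pred V.
Proof.
have [Fs Fl [N FN]] := symtP F; have [Gs Gl [P GP]] := symtP G.
apply/asboolP; split.
- move=> s t; apply: (@sum_splits_perm (fun a b => F a * G b)) => a a' b b'.
  by move=> /Fs -> /Gs ->.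
- move=> a u v s; rewrite /symprod_fun !(sum_splits_cons (fun a b => F a * G b)).
  rewrite mulr_sumr -big_split; apply: eq_bigr => p _ /=.
  by rewrite Fl Gl; ring.
- exists (N + P)%N => s NPs; rewrite /symprod_fun.
  have := size_splits s; rewrite all_map.
  elim: (splits s) => [|p l IH] /=; first by rewrite big_nil.
  move=> /andP[/eqP sp /IH lE]; rewrite big_cons lE addr0.
  have [Np|pN] := ltnP N (size p.1); first by rewrite FN ?mul0r.
  rewrite GP ?mulr0 // ltnNge; apply/negP => pP.
  by move: NPs; rewrite -sp ltnNge leq_add.
Qed.
Definition symprod F G : symt V := Symt (symprod_subproof F G).

Lemma symt0_subproof (a : A) :
  (fun s : seq V => if s is [::] then a else 0 : A^o) \in symt_pred V.
Proof.
apply/asboolP; split=> [s t st|b u v s|].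
- by have := perm_size st; case: s t {st} => [|? ?] [].
- by rewrite mulr0 addr0.
- by exists 0%N => -[].
Qed.
Definition symt0 (a : A) : symt V := Symt (symt0_subproof a).

End SymmetricTensors.
Arguments symt_pred {A} V _.

Section Geometry.
Context {R : realType} {n : nat} {M : smoothManifold R n}.
Local Notation Fn := (cinf M).
Local Notation X1 := (vfield M).
Local Notation O1 := (oneform M).

Record connection := Connection {
  nabla :> X1 -> X1 -> X1;
  nabla_linear_l : forall (f : Fn) X Y Z,
    nabla (f *: X + Y) Z = f *: nabla X Z + nabla Y Z;
  nabla_additive_r : forall X Y Z, nabla X (Y + Z) = nabla X Y + nabla X Z;
  nabla_leibniz : forall (f : Fn) X Y,
    nabla X (f *: Y) = (X f : Fn) *: Y + f *: nabla X Y }.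

Definition torsion_free (D : connection) :=
  forall X Y, D X Y - D Y X = lie X Y.

(* A vector field as a multivector field of degree 1 *)
Lemma symt1_subproof (X : X1) :
  (fun s : seq O1 => if s is [:: a] then a X else 0 : Fn^o) \in symt_pred O1.
Proof.
apply/asboolP; split=> [s t st|b u v s|].
- have := perm_size st; case: s t st => [|a [|? ?]] [|b [|? ?]] //.
  by move=> /perm_mem/(_ a); rewrite !inE eqxx => /esym/eqP ->.
- by case: s => [//|? ?]; rewrite mulr0 addr0.
- by exists 1%N => -[|? []].
Qed.
Definition symt1 (X : X1) : symt O1 := Symt (symt1_subproof X).

(* For P and Q both of degree 0 the degree r + s - 1 is negative, and the
   homogeneity clause gives br P Q = 0. *)
Record is_schouten (D : connection) (br : symt O1 -> symt O1 -> symt O1) : Prop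
    := IsSchouten {
  schouten_linear : forall (c : R) P Q S,
    br (cinf_cst M c *: P + Q) S = cinf_cst M c *: br P S + br Q S;
  schouten_comm : forall P Q, br P Q = br Q P;
  schouten_vfield : forall X Y, br (symt1 X) (symt1 Y) = symt1 (D X Y + D Y X);
  schouten_fun : forall X f, br (symt1 X) (symt0 f) = symt0 (X f);
  schouten_degree : forall r s P Q, homog r P -> homog s Q ->
    forall l, (size l).+1 != (r + s)%N -> br P Q l = 0;
  schouten_derivation : forall r P Q S, homog r P ->
    br P (symprod Q S) = symprod (br P Q) S + symprod Q (br P S) }.

(* The bracket is uniquely determined by D, so that the existential quantifier
   only serves to name it. *)
Definition schouten_self_zero (D : connection) (th : symt O1) :=
  exists2 br, is_schouten D br & br th th = 0.

Definition is_musical (th : symt O1) (S : O1 -> X1) :=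
  forall a b : O1, b (S a) = th [:: a; b].

Definition nondegenerate_biv (th : symt O1) :=
  exists2 S, is_musical th S & bijective S.

Lemma flat_subproof (K : symt X1) (X : X1) :
  (fun Y => K [:: X; Y]) \in oneform_pred M.
Proof.
have [Ks Kl _] := symtP K.
have KC Y : K [:: X; Y] = K [:: Y; X] by 
    by apply: Ks; exact/permPl/(perm_catC [:: X]).
by apply/asboolP => f Y Z; rewrite !KC Kl.
Qed.
Definition flat (K : symt X1) (X : X1) : O1 := OneForm (flat_subproof K X).

Definition nondegenerate_form (K : symt X1) := bijective (flat K).

Definition is_biv_inv (th : symt O1) (K : symt X1) :=
  homog 2 K /\
  exists2 S, is_musical th S & cancel S (flat K) /\ cancel (flat K) S.

(* meaningful for nondegenerate th only, see biv_invP *)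
Definition biv_inv (th : symt O1) : symt X1 := xget 0 [set K | is_biv_inv th K].

Lemma biv_invP th : nondegenerate_biv th -> is_biv_inv th (biv_inv th).
Proof.
move=> [S thS [T ST TS]].
suff [K Kth] : exists K, is_biv_inv th K by exact: (xgetI _ Kth).
have [ths thl _] := symtP th.
have TC X Y : T X Y = T Y X.
  rewrite -{1}(TS Y) -{2}(TS X) !thS; apply: ths.
  exact/permPl/(perm_catC [:: _] [:: _]).
have KP : (fun s : seq X1 => if s is [:: X; Y] then T X Y else 0 : Fn^o)
    \in symt_pred X1.
  apply/asboolP; split=> [s t st|f X Y s|]; last by exists 2%N => -[|? [|? []]].
  - have := perm_size st.
    case: s t st => [|a [|b [|? ?]]] [|c [|d [|? ?]]] // st _.
    have := perm_mem st c; rewrite !inE eqxx /= => /orP[] /eqP cE; subst c.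
      move: st; rewrite perm_cons => /perm_mem/(_ b).
      by rewrite !inE eqxx => /esym/eqP ->.
    move: st; rewrite (perm_catC [:: a] [:: b]) perm_cons => /perm_mem/(_ a).
    by rewrite !inE eqxx => /esym/eqP <-; exact: TC.
  - case: s => [|Z [|? ?]]; rewrite ?mulr0 ?addr0 //.
    by rewrite !(TC _ Z); exact: oneformP.
exists (Symt KP); split=> [[|? [|? [|? ?]]]//|]; exists S => //.
have flatE X : flat (Symt KP) X = T X by apply: val_inj; rewrite funeqE.
by split=> a; rewrite flatE.
Qed.

Definition symmetric_poisson (th : symt O1) (D : connection) :=
  [/\ homog 2 th, torsion_free D & schouten_self_zero D th].

Definition cov_deriv (D : connection) (K : symt X1) (s : seq X1) : Fn :=
  if s is X :: l then
    X (K l) - \sum_(i < size l) K (set_nth 0 l i (D X l`_i))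
  else 0.

Definition sym_proj (T : seq X1 -> Fn) (s : seq X1) : Fn :=
  cinf_cst M ((size s)`!%:R^-1) *
  \sum_(p <- permutations (iota 0 (size s))) T [seq s`_i | i <- p].

Definition sym_deriv (r : nat) (D : connection) (K : symt X1) (s : seq X1) : Fn :=
  r.+1%:R * sym_proj (cov_deriv D K) s.

Definition killing (r : nat) (D : connection) (K : symt X1) :=
  homog r K /\ forall s, size s = r.+1 -> sym_deriv r D K s = 0.

(* For r = 2 the Killing equation is the cyclic identity
   (D_X K)(Y, Z) + (D_Y K)(Z, X) + (D_Z K)(X, Y) = 0. *)
Lemma killing2P (D : connection) (K : symt X1) :
  killing 2 D K <-> homog 2 K /\ forall X Y Z,
    cov_deriv D K [:: X; Y; Z] + cov_deriv D K [:: Y; Z; X] +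
    cov_deriv D K [:: Z; X; Y] = 0.
Proof.
have KC X Y : K [:: X; Y] = K [:: Y; X].
  by case: (symtP K) => Ks _ _; apply: Ks; exact/permPl/(perm_catC [:: X]).
have cE X Y Z : cov_deriv D K [:: X; Y; Z] =
    X (K [:: Y; Z]) - (K [:: D X Y; Z] + K [:: Y; D X Z]) :> Fn.
  by rewrite /cov_deriv /= !big_ord_recl big_ord0 /= addr0.
have cC X Y Z : cov_deriv D K [:: X; Y; Z] = cov_deriv D K [:: X; Z; Y].
  by rewrite !cE (KC Y Z) (KC (D X Y)) (KC Y) [(K _ + _ : Fn)]addrC.
have cst6 : 6%:R * cinf_cst M (6%:R^-1) = 1.
  apply: val_inj; rewrite rmorphM rmorph_nat funeqE => x; rewrite /= fctE.
  suff natE k : (k%:R : M -> R) x = k%:R by rewrite natE /= mulfV // pnatr_eq0.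
  by elim: k => // k IH; rewrite !mulrS -IH.
have e X Y Z : sym_deriv 2 D K [:: X; Y; Z] = cov_deriv D K [:: X; Y; Z] +
    cov_deriv D K [:: Y; Z; X] + cov_deriv D K [:: Z; X; Y].
  rewrite /sym_deriv /sym_proj; move: (cov_deriv D K) cC => F FC.
  rewrite (_ : permutations _ = [:: [:: 1; 0; 2]; [:: 0; 1; 2]; [:: 2; 0; 1];
    [:: 0; 2; 1]; [:: 1; 2; 0]; [:: 2; 1; 0]]%N); last by vm_compute.
  rewrite !big_cons big_nil /= (FC Y X) (FC X Z) (FC Z Y).
  rewrite (_ : 3`! = 6)%N // -[RHS]mul1r -[X in _ = X * _]cst6; ring.
split=> -[hK sK]; split=> //; first by move=> X Y Z; rewrite -e sK.
by move=> [|X [|Y [|Z [|? ?]]]] // _; rewrite e sK.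
Qed.

Definition nondeg_symmetric_poisson (th : symt O1) (D : connection) :=
  symmetric_poisson th D /\ nondegenerate_biv th.

Definition nondeg_killing2 (K : symt X1) (D : connection) :=
  [/\ torsion_free D, killing 2 D K & nondegenerate_form K].

End Geometry.

Arguments connection {R n} M.

(* Main.v *)
(* If th is non-degenerate with inverse K, then evaluating [th, th]_s on the
   1-forms flat K X, flat K Y, flat K Z gives -2 times the cyclic sum of
   (D_X K)(Y, Z), since D th is minus D K through the musical isomorphism.  So
   [th, th]_s = 0 is the Killing equation for K.  This computation is made for
   the explicit bracket \sum_i (i_(e^i) P) (.) D_(e_i) Q + (P <-> Q), which makes
   sense without frames and satisfies the axioms.  That any other bracket agrees
   with it on th is a locality statement: the difference of two brackets is a
   derivation vanishing on functions and vector fields, and for every point x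
   there is a function h with h(x) <> 0 such that h^2 th is a sum of products of
   functions and vector fields.  The latter follows from the existence of
   1-forms w_i and vector fields E_i with h X = \sum_i w_i(X) E_i for all
   derivations X, hence from Hadamard's lemma in a chart. *)
Require Import Defs.
From HB Require Import structures.
From mathcomp Require Import all_boot all_order all_algebra.
From mathcomp Require Import all_classical all_reals all_analysis.
From mathcomp Require Import ring.
Set Implicit Arguments.
Unset Strict Implicit.
Unset Printing Implicit Defensive.
Import Order.TTheory GRing.Theory Num.Theory.
Import numFieldNormedType.Exports.
Local Open Scope classical_set_scope.
Local Open Scope ring_scope.

(** * The bracket attached to a connection *)

Section Splits.
Context {A : comPzRingType} {V : lmodType A}.
Implicit Types s : seq V.

Lemma sum_splitsC (H : seq V -> seq V -> A) s :
  \sum_(p <- splits s) H p.1 p.2 = \sum_(p <- splits s) H p.2 p.1.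
Proof.
elim: s H => [|x s IH] H; first by rewrite !big_seq1.
rewrite sum_splits_cons (sum_splits_cons (fun a b => H b a)).
rewrite (IH (fun a b => H (x :: a) b + H a (x :: b))).
by apply: eq_bigr => p _; rewrite addrC.
Qed.

(** Coassociativity: both sides run over the ways to split [s] into three subsequences. Together
    with [sum_splitsC], it moves any of the three parts to any place. *)
Lemma sum_splitsA (H : seq V -> seq V -> seq V -> A) s :
  \sum_(p <- splits s) \sum_(q <- splits p.2) H p.1 q.1 q.2 =
  \sum_(p <- splits s) \sum_(q <- splits p.1) H q.1 q.2 p.2.
Proof.
elim: s H => [|x s IH] H; first by rewrite !big_seq1.
rewrite (sum_splits_cons (fun a b => \sum_(q <- splits b) H a q.1 q.2)).
rewrite (sum_splits_cons (fun a b => \sum_(q <- splits a) H q.1 q.2 b)).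
under eq_bigr do rewrite (sum_splits_cons (fun a b => H _ a b)) -big_split/=.
under [RHS]eq_bigr do rewrite (sum_splits_cons (fun a b => H a b _)) -big_split/=.
rewrite (IH (fun a b c => H (x :: a) b c + (H a (x :: b) c + H a b (x :: c)))).
by apply: eq_bigr => p _; apply: eq_bigr => q _; rewrite addrA.
Qed.

(** All degree arguments below go through this congruence, which keeps track of the sizes of the two
    parts. *)
Lemma eq_sum_splits (H H' : seq V -> seq V -> A) s :
  (forall a b, (size a + size b)%N = size s -> H a b = H' a b) ->
  \sum_(p <- splits s) H p.1 p.2 = \sum_(p <- splits s) H' p.1 p.2.
Proof.
elim: s H H' => [|x s IH] H H' HH; first by rewrite !big_seq1 HH.
rewrite !sum_splits_cons.
apply: (IH (fun a b => H (x :: a) b + H a (x :: b))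
           (fun a b => H' (x :: a) b + H' a (x :: b))) => a b sE.
by rewrite !HH //= ?addSn ?addnS ?sE.
Qed.

Lemma sum_splits0 (H : seq V -> seq V -> A) s :
  (forall a b, (size a + size b)%N = size s -> H a b = 0) ->
  \sum_(p <- splits s) H p.1 p.2 = 0.
Proof. by move=> H0; rewrite (eq_sum_splits H0) big1. Qed.

(** Counit law: exactly one splitting has an empty first part. *)
Lemma sum_splits_nil (H : seq V -> A) s :
  \sum_(p <- splits s) (if p.1 is [::] then H p.2 else 0) = H s.
Proof.
elim: s H => [|x s IH] H; first by rewrite big_seq1.
rewrite (sum_splits_cons (fun a b => if a is [::] then H b else 0)).
by rewrite -[RHS](IH (fun b => H (x :: b))); apply: eq_bigr => p; rewrite add0r.
Qed.

End Splits.

(** * Evaluation rules for symmetric tensors *)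

Section Tensors.
Context {A : comPzRingType} {V : lmodType A}.
Implicit Types F G H : symt V.

Lemma symt_perm F s t : perm_eq s t -> F s = F t.
Proof. by have [Fs _ _] := symtP F; exact: Fs. Qed.

Lemma symt_linear F a u v s :
  F ((a *: u + v) :: s) = a * F (u :: s) + F (v :: s).
Proof. by have [_ Fl _] := symtP F; exact: Fl. Qed.

Lemma symt_swap F u v s : F [:: u, v & s] = F [:: v, u & s].
Proof. by apply: symt_perm; exact/permPl/(perm_catCA [:: _] [:: _]). Qed.

Lemma symt_cons0 F s : F (0 :: s) = 0.
Proof. by have := symt_linear F (-1) 0 0 s; rewrite scaler0 addr0 mulN1r addNr. Qed.

Lemma symt_scale F a u s : F (a *: u :: s) = a * F (u :: s).
Proof. by rewrite -[a *: u]addr0 symt_linear symt_cons0 addr0. Qed.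

Lemma symt_bound F : exists N, forall s, (N < size s)%N -> F s = 0.
Proof. by have [_ _ ?] := symtP F. Qed.

Lemma symtD F G s : (F + G) s = F s + G s. Proof. by []. Qed.
Lemma symtZ a F s : (a *: F) s = a * F s. Proof. by []. Qed.
Lemma symtN F s : (- F) s = - F s. Proof. by []. Qed.

Lemma symtext F G : F =1 G -> F = G.
Proof. by move=> FG; apply/val_inj/funext. Qed.

Lemma symprodE F G s :
  symprod F G s = \sum_(p <- splits s) F p.1 * G p.2.
Proof. by []. Qed.

Lemma symprod_symt0 a F : symprod (symt0 a) F = a *: F.
Proof.
apply: symtext => s; rewrite symtZ /= /symprod_fun.
rewrite -[F s](sum_splits_nil F) mulr_sumr.
by apply: eq_bigr => -[[|? ?] ?] _ //=; rewrite mul0r mulr0.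
Qed.
End Tensors.

(** * Covariant derivatives of multivector fields and an explicit Schouten bracket *)

Section Bracket.
Context {R : realType} {n : nat} {M : smoothManifold R n}.
Local Notation Fn := (cinf M).
Local Notation X1 := (vfield M).
Local Notation O1 := (oneform M).
Implicit Types (f g h : Fn) (X Y Z : X1) (a b : O1) (P Q S : symt O1).

Lemma vfield_linear X (c : R) f g :
  X (cinf_cst M c * f + g) = cinf_cst M c * X f + X g.
Proof. by have [XD _] := vfieldP X. Qed.

Lemma vfieldM X f g : X (f * g) = f * X g + g * X f.
Proof. by have [_ XM] := vfieldP X. Qed.

Lemma cinf_cst1 : cinf_cst M 1 = 1. Proof. exact: val_inj. Qed.

Lemma vfieldD X f g : X (f + g) = X f + X g.
Proof. by have := vfield_linear X 1 f g; rewrite cinf_cst1 !mul1r. Qed.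

Lemma vfield_0 X : X 0 = 0.
Proof. by apply: (addrI (X 0)); rewrite -vfieldD !addr0. Qed.

Lemma vfieldN X f : X (- f) = - X f.
Proof. by apply/eqP; rewrite -addr_eq0 -vfieldD addNr vfield_0. Qed.

Lemma vfield_sum X (I : Type) (r : seq I) (F : I -> Fn) :
  X (\sum_(i <- r) F i) = \sum_(i <- r) X (F i) :> Fn.
Proof. exact: (big_morph X (vfieldD X) (vfield_0 X)). Qed.

Lemma vfieldcZ X (c : R) f : X (cinf_cst M c * f) = cinf_cst M c * X f.
Proof. by rewrite -[_ * f]addr0 vfield_linear vfield_0 addr0. Qed.

Lemma vfieldext X Y : X =1 Y -> X = Y.
Proof. by move=> XY; apply/val_inj/funext. Qed.

Lemma oneformext a b : a =1 b -> a = b.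
Proof. by move=> XY; apply/val_inj/funext. Qed.

Lemma vfieldZE f X g : (f *: X) g = f * X g. Proof. by []. Qed.
Lemma vfieldDE X Y g : (X + Y) g = X g + Y g. Proof. by []. Qed.
Lemma oneformZE f a X : (f *: a) X = f * a X. Proof. by []. Qed.
Lemma oneformDE a b X : (a + b) X = a X + b X. Proof. by []. Qed.

Lemma differential_subproof f : (fun X : X1 => X f) \in oneform_pred M.
Proof. by apply/asboolP => g X Y. Qed.
Definition differential f : O1 := OneForm (differential_subproof f).

Lemma differential_linear (c : R) f g :
  differential (cinf_cst M c * f + g) =
  cinf_cst M c *: differential f + differential g.
Proof. by apply: oneformext => X; rewrite /= vfield_linear. Qed.

Lemma differentialM f g :
  differential (f * g) = f *: differential g + g *: differential f.
Proof. by apply: oneformext => X; rewrite /= vfieldM. Qed.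

(* Feeding only exact 1-forms to P already gives a derivation, which avoids the
   identification of vector fields with C^oo-linear functionals on 1-forms. *)
Lemma interior_subproof P s :
  (fun f : Fn => P (differential f :: s) : Fn^o) \in @derivation_pred _ _ M.
Proof.
apply/asboolP; split=> [c f g|f g].
  by rewrite differential_linear symt_linear.
by rewrite differentialM symt_linear symt_scale.
Qed.
Definition interior_vfield P s : X1 := VField (interior_subproof P s).

Variable D : connection M.

Lemma cov_oneform_subproof X a :
  (fun Y => (X (a Y) : Fn) - a (D X Y) : Fn^o) \in oneform_pred M.
Proof.
apply/asboolP => f Y Z.
rewrite nabla_additive_r nabla_leibniz -addrA !oneformP vfieldD vfieldM.

have e (x y z t u v : Fn) :
    f * x + y * t + z - (t * y + (f * u + v)) = f * (x - u) + (z - v) by ring.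
exact: e.
Qed.
Definition cov_oneform X a : O1 := OneForm (cov_oneform_subproof X a).

Lemma cov_oneform_linear_l f X Y a :
  cov_oneform (f *: X + Y) a = f *: cov_oneform X a + cov_oneform Y a.
Proof.
apply: oneformext => Z; rewrite /= nabla_linear_l oneformP /=.
have e (x y z t : Fn) : f * x + y - (f * z + t) = f * (x - z) + (y - t) by ring.
exact: e.
Qed.

Lemma cov_oneform_linear_r f X a b :
  cov_oneform X (f *: a + b) =
  f *: cov_oneform X a + ((X f : Fn) *: a + cov_oneform X b).
Proof.
apply: oneformext => Z; rewrite /= vfieldD vfieldM.
have e (x x' y y' z t : Fn) : f * x + y * x' + z - (f * y' + t) =
  f * (x - y') + (x' * y + (z - t)) by ring.
exact: e.
Qed.

(** Summed over the splittings of [s], only singleton first parts count, so each entry of [s] in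
    turn is replaced by its covariant derivative; the symmetry of [Q] allows placing it in front. *)
Definition cov_insert X Q (u v : seq O1) : Fn :=
  if u is [:: a] then Q (cov_oneform X a :: v) else 0.

Definition cov_multivector X Q (s : seq O1) : Fn :=
  X (Q s) - \sum_(p <- splits s) cov_insert X Q p.1 p.2.

Lemma cov_insert_perm X Q u u' v v' : perm_eq u u' -> perm_eq v v' ->
  cov_insert X Q u v = cov_insert X Q u' v'.
Proof.
move=> uu' vv'; case: u u' uu' => [|a [|b u]] u' uu'; have := perm_size uu'.
- by case: u' {uu'}.
- case: u' uu' => [|c [|d u']] // /perm_mem/(_ a); rewrite !inE eqxx.
  by move=> /esym/eqP -> _; apply: symt_perm; rewrite perm_cons.
- by case: u' {uu'} => [|c [|d u']].
Qed.

Lemma cov_multivector_perm X Q s t : perm_eq s t ->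
  cov_multivector X Q s = cov_multivector X Q t.
Proof.
move=> st; rewrite /cov_multivector (symt_perm Q st); congr (_ - _).
by apply: sum_splits_perm st => u u' v v'; exact: cov_insert_perm.
Qed.

Lemma cov_multivector_linear_l f X Y Q s :
  cov_multivector (f *: X + Y) Q s =
  f * cov_multivector X Q s + cov_multivector Y Q s.
Proof.
rewrite /cov_multivector.
have -> : \sum_(p <- splits s) cov_insert (f *: X + Y) Q p.1 p.2 =
    f * (\sum_(p <- splits s) cov_insert X Q p.1 p.2) +
    \sum_(p <- splits s) cov_insert Y Q p.1 p.2.
  rewrite mulr_sumr -big_split; apply: eq_bigr => -[[|a [|? ?]] v] _ /=.
  - by rewrite mulr0 addr0.
  - by rewrite cov_oneform_linear_l symt_linear.
  - by rewrite mulr0 addr0.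
rewrite vfieldDE vfieldZE.
have e (x x' y y' : Fn) : f * x + y - (f * x' + y') = f * (x - x') + (y - y').
  by ring.
exact: e.
Qed.

Lemma cov_multivector_0 Q s : cov_multivector 0 Q s = 0.
Proof.
have := cov_multivector_linear_l (-1) 0 0 Q s.
by rewrite scaler0 addr0 mulN1r addNr.
Qed.

Lemma cov_multivector_linear_r (c : R) X P Q s :
  cov_multivector X (cinf_cst M c *: P + Q) s =
  cinf_cst M c * cov_multivector X P s + cov_multivector X Q s.
Proof.
rewrite /cov_multivector.
have -> : \sum_(p <- splits s) cov_insert X (cinf_cst M c *: P + Q) p.1 p.2 =
    cinf_cst M c * (\sum_(p <- splits s) cov_insert X P p.1 p.2) +
    \sum_(p <- splits s) cov_insert X Q p.1 p.2.
  rewrite mulr_sumr -big_split; apply: eq_bigr => -[[|a [|? ?]] v] _ //=;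
  by rewrite mulr0 addr0.
rewrite symtD symtZ vfield_linear; move: (cinf_cst M c) => f.
have e (x x' y y' : Fn) : f * x + y - (f * x' + y') = f * (x - x') + (y - y').
  by ring.
exact: e.
Qed.

Lemma sum_cov_insert_cons X Q a s :
  \sum_(p <- splits (a :: s)) cov_insert X Q p.1 p.2 =
  Q (cov_oneform X a :: s) + \sum_(p <- splits s) cov_insert X Q p.1 (a :: p.2).
Proof.
rewrite sum_splits_cons big_split /=; congr (_ + _).
rewrite -[RHS](sum_splits_nil (fun v => Q (cov_oneform X a :: v))).
by apply: eq_bigr => -[[|? ?] v].
Qed.

(** Tensoriality in the 1-forms: the term [X f] coming from [X (Q s)] cancels the one from the
    Leibniz rule for [cov_oneform]. *)
Lemma cov_multivector_cons f X Q a b s :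
  cov_multivector X Q ((f *: a + b) :: s) =
  f * cov_multivector X Q (a :: s) + cov_multivector X Q (b :: s).
Proof.
rewrite /cov_multivector !sum_cov_insert_cons cov_oneform_linear_r !symt_linear.
rewrite vfieldD vfieldM.
have -> : \sum_(p <- splits s) cov_insert X Q p.1 ((f *: a + b) :: p.2) =
    f * (\sum_(p <- splits s) cov_insert X Q p.1 (a :: p.2)) +
    \sum_(p <- splits s) cov_insert X Q p.1 (b :: p.2).
  rewrite mulr_sumr -big_split; apply: eq_bigr => -[[|c [|? ?]] v] _ /=.
  - by rewrite mulr0 addr0.
  - by rewrite symt_swap symt_linear; congr (_ * _ + _); exact: symt_swap.
  - by rewrite mulr0 addr0.
have e (x x' y y' z t u u' w : Fn) :
    f * x + y * y' + z - (f * x' + (y' * y + t) + (f * u + u')) =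
    f * (x - (x' + u)) + (z - (t + u')) by ring.
exact: e.
Qed.

Lemma cov_multivector_size0 X Q s : (forall t, size t = size s -> Q t = 0) ->
  cov_multivector X Q s = 0.
Proof.
move=> Q0; rewrite /cov_multivector Q0 // vfield_0 sub0r sum_splits0 ?oppr0 //.
by move=> [|a [|? ?]] v //= sE; rewrite Q0 // -sE.
Qed.

(** Leibniz rule. Everything is written as a sum over splittings into three parts with the
    differentiated entry as the first one; this entry then goes either to [P] or to [Q]. *)
Lemma cov_multivector_prod X P Q s :
  cov_multivector X (symprod P Q) s =
  \sum_(p <- splits s) (cov_multivector X P p.1 * Q p.2 +
                        P p.1 * cov_multivector X Q p.2).
Proof.
rewrite /cov_multivector {1}/symprod /= /symprod_fun vfield_sum.
have -> : \sum_(p <- splits s) cov_insert X (symprod P Q) p.1 p.2 =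
    \sum_(p <- splits s) ((\sum_(q <- splits p.1) cov_insert X P q.1 q.2) * Q p.2
      + P p.1 * (\sum_(q <- splits p.2) cov_insert X Q q.1 q.2)).
  rewrite big_split/=.
  under [X in _ = X + _]eq_bigr do rewrite mulr_suml.
  under [X in _ = _ + X]eq_bigr do rewrite mulr_sumr.
  rewrite -(sum_splitsA (fun u v w => cov_insert X P u v * Q w)).
  rewrite (sum_splitsA (fun u v w => P u * cov_insert X Q v w)).
  under [X in _ = _ + X]eq_bigr do
    rewrite (sum_splitsC (fun u v => P u * cov_insert X Q v _)).
  rewrite -(sum_splitsA (fun u v w => P v * cov_insert X Q u w)) -big_split/=.
  apply: eq_bigr => -[[|a [|? ?]] v] _ /=.
  - by rewrite -big_split big1 // => p _; rewrite /= mul0r mulr0 addr0.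
  - rewrite /symprod_fun (sum_splits_cons (fun u w => P u * Q w)) -big_split.
    by [].
  - by rewrite -big_split big1 // => p _; rewrite /= mul0r mulr0 addr0.
rewrite -sumrB; apply: eq_bigr => p _; rewrite vfieldM.
have e (x x' y y' u v : Fn) :
   x * y' + y * x' - (u * y + x * v) = (x' - u) * y + x * (y' - v) by ring.
exact: e.
Qed.

(* In terms of dual frames e_i, e^i this is \sum_i (i_(e^i) P) (.) D_(e_i) Q. *)
Definition half_bracket_fun P Q (s : seq O1) : Fn^o :=
  \sum_(p <- splits s) cov_multivector (interior_vfield P p.1) Q p.2.

Lemma interior_perm P s t :
  perm_eq s t -> interior_vfield P s = interior_vfield P t.
Proof.
by move=> st; apply: vfieldext => f /=; apply: symt_perm; rewrite perm_cons.
Qed.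

Lemma interior_cons P f a b s : interior_vfield P ((f *: a + b) :: s) =
  f *: interior_vfield P (a :: s) + interior_vfield P (b :: s).
Proof.
apply: vfieldext => g; rewrite vfieldDE vfieldZE /=.
by rewrite symt_swap symt_linear; congr (_ * _ + _); exact: symt_swap.
Qed.

Lemma interior_size0 P s : (forall t, size t = (size s).+1 -> P t = 0) ->
  interior_vfield P s = 0.
Proof. by move=> P0; apply: vfieldext => f /=; rewrite P0. Qed.

Lemma half_bracket_subproof P Q : half_bracket_fun P Q \in symt_pred O1.
Proof.
apply/asboolP; split.
- move=> s t; apply: (@sum_splits_perm _ _
    (fun u v => cov_multivector (interior_vfield P u) Q v)) => u u' v v' uu' vv'.
  by rewrite (interior_perm P uu'); exact: cov_multivector_perm.
- move=> f a b s; rewrite /half_bracket_fun.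
  rewrite !(sum_splits_cons (fun u v => cov_multivector (interior_vfield P u) Q v)).
  rewrite mulr_sumr -big_split; apply: eq_bigr => p _ /=.
  rewrite interior_cons cov_multivector_linear_l cov_multivector_cons.
  have e (x x' y y' : Fn) : f * x + y + (f * x' + y') =
    f * (x + x') + (y + y') by ring.
  exact: e.
- have [N PN] := symt_bound P; have [N' QN] := symt_bound Q.
  exists (N + N')%N => s Ns; rewrite /half_bracket_fun.
  apply: (sum_splits0 (H := fun u v => cov_multivector (interior_vfield P u) Q v)).
  move=> u v uv; have [Nu|uN] := leqP N (size u).
    rewrite interior_size0 ?cov_multivector_0 // => t tE.
    by rewrite PN // tE ltnS.
  apply: cov_multivector_size0 => t tE; rewrite QN // tE.
  by rewrite -(ltn_add2l N) (leq_trans Ns) // -uv leq_add2r ltnW.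
Qed.
Definition half_bracket P Q : symt O1 := Symt (half_bracket_subproof P Q).

Lemma half_bracketE P Q s : half_bracket P Q s =
  \sum_(p <- splits s) cov_multivector (interior_vfield P p.1) Q p.2.
Proof. by []. Qed.

Lemma half_bracket_linear_r (c : R) P Q S :
  half_bracket P (cinf_cst M c *: Q + S) =
  cinf_cst M c *: half_bracket P Q + half_bracket P S.
Proof.
apply: symtext => s; rewrite symtD symtZ !half_bracketE mulr_sumr.
by rewrite -big_split; apply: eq_bigr => p _; exact: cov_multivector_linear_r.
Qed.

Lemma half_bracket_linear_l f P Q S :
  half_bracket (f *: P + Q) S = f *: half_bracket P S + half_bracket Q S.
Proof.
apply: symtext => s; rewrite symtD symtZ !half_bracketE mulr_sumr.
rewrite -big_split; apply: eq_bigr => p _; rewrite /= -cov_multivector_linear_l.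
by congr (cov_multivector _ _ _); exact: vfieldext.
Qed.

(** Contraction uses up one slot of [P], so a nonzero term needs parts of sizes [r - 1] and [r']. *)
Lemma half_bracket_homog r r' P Q s : homog r P -> homog r' Q ->
  (size s).+1 != (r + r')%N -> half_bracket P Q s = 0.
Proof.
move=> rP rQ sr.
apply: (sum_splits0 (H := fun u v => cov_multivector (interior_vfield P u) Q v)).
move=> u v uv; have [ur|/eqP ur] := eqVneq (size u).+1 r; last first.
  rewrite interior_size0 ?cov_multivector_0 // => t tE.
  by rewrite rP // tE; exact/eqP.
apply: cov_multivector_size0 => t tE; rewrite rQ // tE.
by apply: contra_neq sr => vr'; rewrite -uv -ur -vr' addSn.
Qed.

(** In the second argument the derivation property comes from the Leibniz rule for the covariant
    derivative, in the first one ([half_bracket_prod_l]) from that of the contraction. *)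
Lemma half_bracket_prod_r P Q S : half_bracket P (symprod Q S) =
  symprod (half_bracket P Q) S + symprod Q (half_bracket P S).
Proof.
apply: symtext => s; rewrite symtD half_bracketE !symprodE.
under eq_bigr do rewrite cov_multivector_prod big_split.
rewrite big_split/=.
rewrite (sum_splitsA (fun u v w => cov_multivector (interior_vfield P u) Q v * S w)).
rewrite (sum_splitsA (fun u v w => Q v * cov_multivector (interior_vfield P u) S w)).
congr (_ + _).
  by apply: eq_bigr => p _; rewrite mulr_suml.
under [RHS]eq_bigr do rewrite mulr_sumr.
rewrite (sum_splitsA (fun u v w => Q u * cov_multivector (interior_vfield P v) S w)).
apply: eq_bigr => p _.
exact: (sum_splitsC (fun u v => Q v * cov_multivector (interior_vfield P u) S p.2)).
Qed.

Lemma interior_prod P Q s f : interior_vfield (symprod P Q) s f =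
  \sum_(p <- splits s)
    (Q p.2 * interior_vfield P p.1 f + P p.1 * interior_vfield Q p.2 f).
Proof.
rewrite /= /symprod_fun (sum_splits_cons (fun u v => P u * Q v)).
by apply: eq_bigr => p _; rewrite [Q p.2 * _]mulrC.
Qed.

Lemma cov_multivector_sum_l (I : Type) (r : seq I) (c : I -> Fn) (F : I -> X1)
    Q s :
  cov_multivector (\sum_(i <- r) c i *: F i) Q s =
  \sum_(i <- r) c i * cov_multivector (F i) Q s.
Proof.
elim: r => [|i r IH]; first by rewrite !big_nil cov_multivector_0.
by rewrite !big_cons cov_multivector_linear_l IH.
Qed.

Lemma vfield_sumE (I : Type) (r : seq I) (F : I -> X1) f :
  (\sum_(i <- r) F i) f = \sum_(i <- r) F i f.
Proof. by elim: r => [|i r IH]; rewrite ?big_nil ?big_cons // vfieldDE IH. Qed.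

Lemma half_bracket_prod_l P Q S : half_bracket (symprod Q S) P =
  symprod (half_bracket Q P) S + symprod Q (half_bracket S P).
Proof.
apply: symtext => s; rewrite symtD half_bracketE !symprodE.
(* The coefficients [S p.2] and [Q p.1] are functions on [M], so they can be taken out of
   [cov_multivector], which is linear over functions in its vector field. *)
have E u : interior_vfield (symprod Q S) u =
    \sum_(p <- splits u) S p.2 *: interior_vfield Q p.1 +
    \sum_(p <- splits u) Q p.1 *: interior_vfield S p.2.
  apply: vfieldext => f; rewrite interior_prod big_split vfieldDE !vfield_sumE.
  by [].
under eq_bigr do rewrite E -[X in cov_multivector (X + _)]scale1r
  cov_multivector_linear_l mul1r !cov_multivector_sum_l.
rewrite big_split/=.
rewrite -(sum_splitsA (fun u v w => S v * cov_multivector (interior_vfield Q u) P w)).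
rewrite -(sum_splitsA (fun u v w => Q u * cov_multivector (interior_vfield S v) P w)).
congr (_ + _); last by apply: eq_bigr => p _; rewrite mulr_sumr.
under [RHS]eq_bigr do rewrite mulr_suml.
rewrite -(sum_splitsA (fun u v w => cov_multivector (interior_vfield Q u) P v * S w)).
apply: eq_bigr => p _.
rewrite (sum_splitsC (fun u v => S u * cov_multivector _ _ v)).
by apply: eq_bigr => q _; rewrite mulrC.
Qed.

Lemma homog_symt1 X : homog 1 (symt1 X).
Proof. by move=> [|? [|? ?]]. Qed.

Lemma homog_symt0 f : homog 0 (symt0 f : symt O1).
Proof. by move=> [|? ?]. Qed.

Lemma half_bracket_symt1 X Y : half_bracket (symt1 X) (symt1 Y) = symt1 (D X Y).
Proof.
apply: symtext => s; have [|s1] := eqVneq (size s) 1%N; last first.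
  by rewrite homog_symt1 // (half_bracket_homog (homog_symt1 X) (homog_symt1 Y)).
(* Of the two splittings of [[:: a]], the one feeding [a] to [symt1 X] vanishes for degree reasons;
   the other gives [X (a Y) - (X (a Y) - a (D X Y))]. *)
case: s => [|a [|? ?]] // _; rewrite half_bracketE /= big_cons big_seq1.
rewrite [interior_vfield _ [:: a]]interior_size0 => [|[|? [|? ?]]] //=.
rewrite cov_multivector_0 add0r (_ : interior_vfield _ _ = X); last exact: vfieldext.
rewrite /cov_multivector sum_cov_insert_cons big_seq1 addr0 /=.
by rewrite opprB addrC subrK.
Qed.

Lemma half_bracket_symt1_symt0 X f :
  half_bracket (symt1 X) (symt0 f) = symt0 (X f).
Proof.
apply: symtext => s; have [|s1] := eqVneq (size s) 0%N; last first.
  by rewrite homog_symt0 // (half_bracket_homog (homog_symt1 X) (homog_symt0 f)).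
case: s => [|? ?] // _; rewrite half_bracketE /= big_seq1.
by rewrite (_ : interior_vfield _ _ = X); [rewrite /cov_multivector big_seq1 subr0
  |exact: vfieldext].
Qed.

Lemma half_bracket_symt0 f Q : half_bracket (symt0 f) Q = 0.
Proof.
apply: symtext => s; rewrite half_bracketE big1 // => p _.
by rewrite interior_size0 ?cov_multivector_0 // => -[].
Qed.

Definition schouten P Q : symt O1 := half_bracket P Q + half_bracket Q P.

Lemma symprodDl P Q S : symprod (P + Q) S = symprod P S + symprod Q S.
Proof.
apply: symtext => s; rewrite symtD !symprodE -big_split.
by apply: eq_bigr => p _; rewrite symtD mulrDl.
Qed.

Lemma symprodDr P Q S : symprod S (P + Q) = symprod S P + symprod S Q.
Proof.
apply: symtext => s; rewrite symtD !symprodE -big_split.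
by apply: eq_bigr => p _; rewrite symtD mulrDr.
Qed.

(** Both halves are derivations of the symmetric product, and symmetrizing turns [D X Y] into
    [D X Y + D Y X]. *)
Lemma schoutenP : is_schouten D schouten.
Proof.
split=> [c P Q S|P Q|X Y|X f|r s P Q rP sQ l lE|r P Q S _].
- rewrite /schouten half_bracket_linear_l half_bracket_linear_r scalerDr.
  exact: addrACA.
- exact: addrC.
- rewrite /schouten !half_bracket_symt1; apply: symtext => -[|a [|? ?]];
  by rewrite symtD /= ?addr0 // -[D X Y]scale1r oneformP scale1r [_ *: _]mul1r.
- by rewrite /schouten half_bracket_symt1_symt0 half_bracket_symt0 addr0.
- rewrite symtD (half_bracket_homog rP sQ) // (half_bracket_homog sQ rP) ?addr0 //.
  by rewrite addnC.
- rewrite /schouten half_bracket_prod_l half_bracket_prod_r symprodDl symprodDr.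
  exact: addrACA.
Qed.

End Bracket.

(** * C^k functions on R^n *)

Section CkTheory.
Context {R : realType} {n : nat}.
Local Notation V := 'rV[R]_n.
Local Notation e_ i := (delta_mx 0 i : V).
Implicit Types (U W : set V) (f g : V -> R).

(** [Ck] is a condition at each point of the set, with derivatives taken in the whole space, so it
    can be checked on any sets that cover [U]. *)
Lemma Ck_local k U f :
  (forall x, U x -> exists2 W, W x & Ck k W f) -> Ck k U f.
Proof.
elim: k f => [|k IH] f Uf /=; first by move=> x /Uf[W Wx]; exact.
split=> [x /Uf[W Wx [+ _]]|v]; first exact.
by apply: IH => x /Uf[W Wx [_ Wf]]; exists W => //; exact: Wf.
Qed.

Lemma Ck_subset k U W f : U `<=` W -> Ck k W f -> Ck k U f.
Proof. by move=> UW Wf; apply: Ck_local => x /UW Wx; exists W. Qed.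

Lemma Ck_coord k U (j : 'I_n) : open U -> Ck k U (fun y : V => y 0 j).
Proof.
move=> oU; case: k => [|k] /=; first by move=> x _; exact: coord_continuous.
have d (x : V) : differentiable (fun y : V => y 0 j) x.
  exact: differentiable_coord.
split=> [x _|v]; first exact: d.
apply: eq_Ck (Ck_cst k (v 0 j) oU) => // x _.
rewrite deriveE // [RHS](_ : _ = v 0 j) //.
pose L : V -> R := fun y => y 0 j.
have Llin : linear L by move=> a u w; rewrite /L !mxE.
pose LL := GRing.isLinear.Build _ _ _ _ L Llin.
pose L' : {linear V -> R} := HB.pack L LL.
by rewrite -[fun y : V => y 0 j]/(L' : V -> R) diff_lin //; exact: coord_continuous.
Qed.

Lemma Ck_sum k U (I : Type) (r : seq I) (F : I -> V -> R) : open U ->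
  (forall i, Ck k U (F i)) -> Ck k U (\sum_(i <- r) F i).
Proof.
move=> oU UF; elim: r => [|i r IH]; first by rewrite big_nil; exact: (Ck_cst k 0).
by rewrite big_cons; exact: CkD.
Qed.

Lemma Ck_0 k U f : Ck k U f -> Ck 0 U f.
Proof. by elim: k => // k IH /CkS. Qed.

Lemma Ck_differentiable k U f x : Ck k.+1 U f -> U x -> differentiable f x.
Proof. by move=> [+ _]; exact. Qed.

Lemma derive_sum_coord f (x v : V) : differentiable f x ->
  'D_v f x = \sum_i v 0 i * 'D_(e_ i) f x.
Proof.
move=> df; rewrite deriveE // {1}[v]row_sum_delta linear_sum.
by apply: eq_bigr => i _; rewrite linearZ deriveE.
Qed.

Lemma differentiable_rV (V' : normedModType R) (F : V' -> V) (x : V') :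
  (forall j, differentiable (fun y => F y 0 j) x) -> differentiable F x.
Proof.
move=> dF.
have -> : F = \sum_(j < n) (fun y => F y 0 j *: e_ j).
  apply/funext => y; rewrite [LHS]row_sum_delta fct_sumE.
  by [].
by apply: differentiable_sum => j; exact: differentiableZl.
Qed.

Lemma continuous_rV (T : topologicalType) (F : T -> V) (x : T) :
  (forall j, {for x, continuous (fun y => F y 0 j)}) -> {for x, continuous F}.
Proof.
move=> cF; apply/cvgrPdist_le => /= e e0.
near=> y; rewrite [leLHS]/Num.Def.normr/= mx_normrE (bigmax_le _ (ltW e0))//=.
move=> [i j] _; rewrite !mxE/= ord1; move: j; near: y; apply: filter_forall => j.
exact: ((cvgrPdist_le _ _).1 (cF j)).
Unshelve. all: by end_near. Qed.

Lemma Ck_comp k U W (F : V -> V) g : open U -> open W ->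
  (forall x, U x -> W (F x)) -> (forall j, Ck k U (fun y => F y 0 j)) ->
  Ck k W g -> Ck k U (g \o F).
Proof.
move=> oU oW UW; elim: k g => [|k IH] g UF Wg.
  move=> x Ux; apply: continuous_comp; last exact/Wg/UW.
  by apply: continuous_rV => j; exact: UF.
have dF x : U x -> differentiable F x.
  by move=> Ux; apply: differentiable_rV => j; exact: Ck_differentiable (UF j) Ux.
have dg x : U x -> differentiable g (F x).
  by move=> Ux; exact: Ck_differentiable Wg (UW _ Ux).
split=> [x Ux|v]; first by apply: differentiable_comp; [exact: dF|exact: dg].
(* The chain rule in coordinates; the induction hypothesis applies to the factors
   ['D_(e_ j) g \o F]. *)
pose G := \sum_j ((fun y => 'D_v (fun z => F z 0 j) y) * ('D_(e_ j) g \o F)).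
have CG : Ck k U G.
  apply: Ck_sum => // j; apply: CkM => //; first by have [_ H] := UF j; exact: H.
  apply: IH => [i|]; first by have := UF i; exact: CkS.
  by have [_ H] := Wg; exact: H.
apply: eq_Ck CG => // x Ux.
rewrite deriveE; last by apply: differentiable_comp; [exact: dF|exact: dg].
rewrite diff_comp /=; [|exact: dF|exact: dg].
rewrite -!deriveE; [|exact: dF|exact: dg].
rewrite derive_sum_coord; last exact: dg.
rewrite derive_mx; last exact/diff_derivable/dF.
by rewrite /G fct_sumE; apply: eq_bigr => j _; rewrite mxE.
Qed.

Lemma smooth_on_setT U (K : set V) h : open U -> closed K ->
  (forall y, ~ K y -> h y = 0) -> K `<=` U -> smooth_on U h -> smooth_on setT h.
Proof.
move=> oU cK hK KU sh k; apply: Ck_local => x _.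
have [Ux|nUx] := pselect (U x); first by exists U.
exists (~` K); first by move=> /KU.
apply: eq_Ck (Ck_cst k 0 (closed_openC cK)); first exact: closed_openC.
by move=> y /hK ->.
Qed.

End CkTheory.

(** * Smooth bump functions *)

Section Bump.
Context {R : realType}.

(** The bump only uses [m = 0]; the other values of [m] make the linear span of the family closed
    under differentiation. *)
Definition flat_exp (m : nat) (t : R) : R :=
  if 0 < t then t ^- m * expR (- t^-1) else 0.

(** A quadratic bound is what gives a zero derivative at the origin. *)
Lemma flat_exp_bound m t : `|flat_exp m t| <= m.+2%:R ^+ m.+2 * t ^+ 2.
Proof.
rewrite /flat_exp; case: ifPn => [t0|_]; last first.
  by rewrite normr0 mulr_ge0 ?sqr_ge0 // exprn_ge0 // ler0n.
have m0 : (0 : R) < m.+2%:R by rewrite ltr0n.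
rewrite ger0_norm; last by rewrite mulr_ge0 ?expR_ge0 // invr_ge0 exprn_ge0 // ltW.
(* exp (-1/t) = exp (- 1/(kt))^k <= (kt)^k with k = m + 2 *)
have e1 : expR (- t^-1) <= (m.+2%:R * t) ^+ m.+2.
  have -> : - t^-1 = m.+2%:R * - (m.+2%:R * t)^-1.
    by rewrite invfM mulrN mulrA mulfV ?mul1r // gt_eqF.
  have mt0 : 0 < m.+2%:R * t by rewrite mulr_gt0.
  rewrite expRM_natl lerXn2r ?nnegrE ?expR_ge0 ?(ltW mt0) //.
  rewrite expRN invf_ple ?posrE ?expR_gt0 //.
  by apply: le_trans (expR_ge1Dx _); rewrite lerDr.
apply: le_trans (ler_wpM2l _ e1) _; first by rewrite invr_ge0 exprn_ge0 // ltW.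
rewrite exprMn mulrCA ler_wpM2l ?exprn_ge0 ?(ltW m0) //.
by rewrite -addn2 exprD mulrA mulVf ?mul1r ?expf_neq0 ?gt_eqF.
Qed.

Lemma is_derive_flat_exp (m : nat) (t : R) :
  is_derive t 1 (flat_exp m) (flat_exp m.+2 t - m%:R * flat_exp m.+1 t).
Proof.
have [t0|t0|->] := ltgtP t 0.
- apply: (@near_eq_is_derive _ _ _ (cst 0)).
    near=> s; rewrite /flat_exp; case: ifPn => // s0.
    exfalso; suff : s < 0 by rewrite ltNge (ltW s0).
    by near: s; exact: lt_nbhsl.
  by rewrite /flat_exp !ltNge (ltW t0) /= mulr0 subr0; exact: is_derive_cst.
- pose g (s : R) := s^-1.
  have tn0 : t != 0 by rewrite gt_eqF.
  have dg : is_derive t 1 g (- t ^- 2).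
    apply: DeriveDef.
      by apply: (@derivableV _ _ id) => //; exact: derivable_id.
    by rewrite (@deriveV _ _ id) // derive_id scaler1.
  have de : is_derive t 1 (expR \o (- g)) (expR (- g t) * - (- t ^- 2)).
    exact: is_derive1_comp.
  apply: (@near_eq_is_derive _ _ _ (g ^+ m * (expR \o (- g)))).
    near=> s; rewrite /flat_exp ifT; first by rewrite !fctE exprVn.
    by near: s; exact: lt_nbhsr.
  apply: is_derive_eq; rewrite /flat_exp t0 /GRing.scale/= !fctE /g.
  have uE k : t ^- k = t^-1 ^+ k by rewrite exprVn.
  move: (expR _) => E.
  by case: m => [|m]; rewrite /= !uE ?expr0 ?exprS; ring.
- rewrite /flat_exp ltxx mulr0 subr0.
  (* By the quadratic bound, the difference quotient at 0 is at most [C * |h|]. *)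
  have l0 : h^-1 *: (flat_exp m (h *: (1 : R) + 0) - flat_exp m 0)
      @[h --> 0^'] --> (0 : R).
    rewrite {2}/flat_exp ltxx; set C := m.+2%:R ^+ m.+2 : R.
    have C0 : 0 <= C by rewrite exprn_ge0 // ler0n.
    apply/cvgr0Pnorm_le => e e0; near=> h.
    have h0 : h != 0 by near: h; exact: nbhs_dnbhs_neq.
    rewrite subr0 addr0 normrM normfV [h *: _]mulr1 ler_pdivrMl ?normr_gt0 //.
    apply: le_trans (flat_exp_bound _ _) _.
    rewrite -[h ^+ 2]ger0_norm ?sqr_ge0 // normrX expr2 mulrCA ler_wpM2l //.
    have : `|h| <= e / (C + 1).
      by near: h; apply: dnbhs0_le; rewrite divr_gt0 // ltr_wpDl.
    rewrite ler_pdivlMr ?ltr_wpDl // => he; apply: le_trans he.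
    by rewrite mulrDr mulr1 [C * _]mulrC lerDl.
  apply: DeriveDef; last exact: cvg_lim l0.
  by apply/cvg_ex; exists 0.
Unshelve. all: by end_near. Qed.

End Bump.

Section SmoothBump.
Context {R : realType} {n : nat}.
Local Notation V := 'rV[R]_n.
Implicit Types (U : set V).

(** Induction on [k] for all [m] at once, since differentiation raises [m]. *)
Lemma Ck_flat_exp k m U (q : V -> R) : open U -> smooth_on U q ->
  Ck k U (flat_exp m \o q).
Proof.
move=> oU Uq.
have dq x : U x -> differentiable q x by exact: Ck_differentiable (Uq 1%N).
have df p x : differentiable (flat_exp p) (x : R).
  by apply/derivable1_diffP; have [] := is_derive_flat_exp p x.
have dfq p x : U x -> differentiable (flat_exp p \o q) x.
  by move=> /dq ?; exact: differentiable_comp.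
elim: k m => [|k IH] m; first by move=> x Ux; exact/differentiable_continuous/dfq.
split=> [x Ux|v]; first exact: dfq.
pose G := (fun y => 'D_v q y) *
  ((flat_exp m.+2 \o q) + cst (- m%:R) * (flat_exp m.+1 \o q)).
have CG : Ck k U G.
  apply: CkM => //; first by have [_ H] := Uq k.+1; exact: H.
  by apply: CkD => //; apply: CkM => //; exact: Ck_cst.
apply: eq_Ck CG => // x Ux.
have -> : 'D_v (flat_exp m \o q) x =
    (flat_exp m.+2 (q x) - m%:R * flat_exp m.+1 (q x)) * 'D_v q x.
  rewrite deriveE; last exact: dfq.
  rewrite diff_comp /=; [|exact: dq|exact: df].
  rewrite -(deriveE v (dq _ Ux)).
  rewrite diff1E; last exact: df.
  by rewrite derive1E; have [_ ->] := is_derive_flat_exp m (q x); exact: mulrC.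
by rewrite /G !fctE /= mulNr mulrC.
Qed.

Lemma rV_norm_lt (v : V) (r : R) : 0 < r -> (forall j, `|v 0 j| < r) -> `|v| < r.
Proof.
move=> r0 vr; rewrite [ltLHS]/Num.Def.normr/= mx_normrE.
by apply: bigmax_lt => //= -[i j] _; rewrite ord1.
Qed.

Lemma rV_norm_ge (v : V) j : `|v 0 j| <= `|v|.
Proof.
rewrite [leRHS]/Num.Def.normr/= mx_normrE.
exact: (le_bigmax _ (fun ij : 'I_1 * 'I_n => `|v ij.1 ij.2|) (0, j)).
Qed.

Lemma smooth_bump (a : V) (r : R) : 0 < r ->
  exists psi : V -> R, [/\ smooth_on setT psi, psi a != 0 &
    forall y, r <= `|y - a| -> psi y = 0].
Proof.
move=> r0; pose u j : V -> R := (fun y : V => y 0 j) + cst (- a 0 j).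
(* The Euclidean square makes [q] polynomial, whereas [|y - a|] is the sup norm. It dominates the
   square of each coordinate, so [q y <= 0] once [r <= |y - a|]. *)
pose q : V -> R := cst (r ^+ 2) + cst (-1) * \sum_j (u j * u j).
have qE y : q y = r ^+ 2 - \sum_j (y 0 j - a 0 j) ^+ 2.
  by rewrite /q !fctE fct_sumE mulN1r.
have sq : smooth_on setT q.
  move=> k; apply: CkD; [exact: openT|exact/Ck_cst/openT|].
  apply: CkM; [exact: openT|exact/Ck_cst/openT|].
  have su j : Ck k setT (u j).
    by apply: CkD; [exact: openT|exact/Ck_coord/openT|exact/Ck_cst/openT].
  by apply: Ck_sum => [|j]; [exact: openT|apply: CkM => //; exact: openT].
exists (flat_exp 0 \o q); split.
- by move=> k; apply: Ck_flat_exp => //; exact: openT.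
- rewrite /= qE big1 => [|j _]; last by rewrite subrr expr0n.
  rewrite subr0 /flat_exp exprn_gt0 // expr0 invr1 mul1r gt_eqF //.
  exact: expR_gt0.
- move=> y; rewrite /= qE /flat_exp leNgt; case: ifPn => // /[swap] /negP + q0.
  case; apply: rV_norm_lt => // j; rewrite !mxE.
  rewrite -(ltr_pXn2r (n := 2)) ?nnegrE // ?(ltW r0) // -normrX ger0_norm ?sqr_ge0 //.
  move: q0; rewrite subr_gt0; apply: le_lt_trans.
  by rewrite (bigD1 j) //= lerDl sumr_ge0 // => i _; rewrite sqr_ge0.
Qed.

End SmoothBump.

(** * Hadamard's lemma *)

Section MeanValue.
Context {R : realType}.
Local Notation mu := (@lebesgue_measure R).
Implicit Types f g : R -> R.

Definition mean f : R := (\int[mu]_(s in `[0%R, 1%R]) f s)%R.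

Let cont f := forall s : R, 0 <= s <= 1 -> {for s, continuous f}.

Lemma mean_integrable f : (forall s, 0 <= s <= 1 -> {for s, continuous f}) ->
  mu.-integrable `[0%R, 1%R] (EFin \o f).
Proof.
move=> cf; apply: continuous_compact_integrable; first exact: segment_compact.
apply: continuous_in_subspaceT => s; rewrite inE/= in_itv/=; exact: cf.
Qed.

Lemma meanD f g : cont f -> cont g -> mean (fun s => f s + g s) = mean f + mean g.
Proof. by move=> cf cg; apply: RintegralD => //; exact: mean_integrable. Qed.

Lemma meanB f g : cont f -> cont g -> mean (fun s => f s - g s) = mean f - mean g.
Proof. by move=> cf cg; apply: RintegralB => //; exact: mean_integrable. Qed.

Lemma meanZ c f : cont f -> mean (fun s => c * f s) = c * mean f.
Proof. by move=> cf; apply: RintegralZl => //; exact: mean_integrable. Qed.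

Lemma mean_cst c : mean (fun=> c) = c.
Proof.
rewrite /mean Rintegral_cst //= lebesgue_measure_itv /= lte_fin ltr01.
by rewrite oppr0 addr0 mulr1.
Qed.

Lemma eq_mean f g : (forall s, 0 <= s <= 1 -> f s = g s) -> mean f = mean g.
Proof. by move=> fg; apply: eq_Rintegral => s; rewrite inE/= in_itv/=; exact: fg. Qed.

Lemma mean_norm_le f c : cont f -> (forall s, 0 <= s <= 1 -> `|f s| <= c) ->
  `|mean f| <= c.
Proof.
move=> cf fc; have mf := mean_integrable cf.
apply: (le_trans (le_normr_Rintegral _ mf)) => //.
rewrite -[leRHS]mean_cst; apply: le_Rintegral => //.
- apply: mean_integrable => s /cf cs; exact: cvg_norm cs.
- by apply: mean_integrable => s _; exact: cst_continuous.
Qed.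

(** Continuity is proved along with the value because the induction step needs it for [meanD]. *)
Lemma mean_sum (I : Type) (r : seq I) (c : I -> R) (F : I -> R -> R) :
  (forall i, cont (F i)) ->
  cont (fun s => \sum_(i <- r) c i * F i s) /\
  mean (fun s => \sum_(i <- r) c i * F i s) = \sum_(i <- r) c i * mean (F i).
Proof.
move=> cF; elim: r => [|i r [IHc IHm]].
  have E : (fun s : R => \sum_(i <- [::]) c i * F i s) = cst 0.
    by apply/funext => s; rewrite big_nil.
  by rewrite E big_nil mean_cst; split=> // s _; exact: cst_continuous.
have E : (fun s => \sum_(j <- i :: r) c j * F j s) =
    (fun s => c i * F i s + \sum_(j <- r) c j * F j s).
  by apply/funext => s; rewrite big_cons.
have cZ : cont (fun s => c i * F i s).
  by move=> s /(cF i) cs; apply: cvgMl_tmp.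
rewrite E big_cons meanD // meanZ // IHm; split=> // s s01.
by apply: cvgD; [exact: cZ|exact: IHc].
Qed.

Lemma mean_derive (F f : R -> R) : cont f ->
  (forall s : R, 0 <= s <= 1 -> is_derive s (1 : R) F (f s)) -> mean f = F 1 - F 0.
Proof.
move=> cf dF.
have cF (s : R) : 0 <= s <= 1 -> {for s, continuous F}.
  by move=> /dF dFs; apply/differentiable_continuous/derivable1_diffP.
rewrite /mean /Rintegral (continuous_FTC2 (F := F)) //.
- apply: continuous_in_subspaceT => s; rewrite inE/= in_itv/=; exact: cf.
- split.
  + by move=> s; rewrite in_itv/= => /andP[s0 s1]; have [] := dF s; rewrite ?ltW.
  + by apply: cvg_at_right_filter; apply: cF; rewrite lexx ler01.
  + by apply: cvg_at_left_filter; apply: cF; rewrite lexx ler01.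
- move=> s; rewrite in_itv/= => /andP[s0 s1]; rewrite derive1E.
  by have [|_ ->] := dF s; rewrite ?ltW.
Qed.

End MeanValue.

(** * Differentiation under the integral sign along rays *)

Section Hadamard.
Context {R : realType} {n : nat}.
Local Notation V := 'rV[R]_n.
Local Notation e_ i := (delta_mx 0 i : V).
Implicit Types (f : V -> R) (U : set V).

(** A differentiability criterion with prescribed partial derivatives [c i], in the form in which
    the estimate for [ray_mean] is obtained. *)
Lemma differentiable_bound f (x : V) (c : 'I_n -> R) :
  (forall e, 0 < e -> \forall v \near (0 : V),
     `|f (v + x) - f x - \sum_i v 0 i * c i| <= e * `|v|) ->
  differentiable f x /\ forall v, 'D_v f x = \sum_i v 0 i * c i.
Proof.
move=> fP; pose L (v : V) := \sum_i v 0 i * c i.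
have Llin : linear L.
  move=> a u w; rewrite /L scaler_sumr -big_split; apply: eq_bigr => i _ /=.
  by rewrite !mxE mulrDl -mulrA.
pose LL := GRing.isLinear.Build _ _ _ _ L Llin.
pose L' : {linear V -> R} := HB.pack L LL.
have Lc : continuous (L' : V -> R).
  have -> : (L' : V -> R) = \sum_i ((fun v : V => v 0 i) * cst (c i)).
    by apply/funext => v; rewrite fct_sumE.
  move=> v; apply: (@Ck_sum _ _ 0 setT _ _ _ openT) => // i.
  by apply: (@CkM _ _ 0 _ _ _ openT); [exact/Ck_coord/openT|exact/Ck_cst/openT].
have fo : f \o shift x = cst (f x) + L' +o_ (0 : V) id.
  apply/eqaddoP => e e0; near=> v.
  rewrite [X in `|X|](_ : _ = f (v + x) - f x - \sum_i v 0 i * c i); last first.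
    by rewrite !fctE /= opprD addrA.
  by near: v; exact: fP.
have dfL : 'd f x = L' :> (V -> R) by exact: diff_unique.
have df : differentiable f x by apply/diff_locallyP; rewrite dfL.
by split=> // v; rewrite deriveE // dfL.
Unshelve. all: by end_near. Qed.

(** Compactness of the unit interval makes continuity uniform along the segment. The bound
    [|w| <= |v|] lets one [v] control all shrunken displacements such as [s *: v]. *)
Lemma segment_near_uniform f (p z : V) (e : R) : 0 < e ->
  (forall s : R, 0 <= s <= 1 -> {for p + s *: (z - p), continuous f}) ->
  \forall v \near (0 : V), forall s w, 0 <= s <= 1 -> `|w| <= `|v| ->
    `|f (p + s *: (z - p) + w) - f (p + s *: (z - p))| <= e.
Proof.
move=> e0 cf.
have e20 : 0 < e / 2 by rewrite divr_gt0.
suff /nbhs_ballP[d /= d0 dP] : \forall w \near (0 : V), `[0, 1] `<=` (fun s : R =>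
    `|f (p + s *: (z - p) + w) - f (p + s *: (z - p))| <= e).
  apply/nbhs_ballP; exists d => //= v; rewrite -ball_normE /= sub0r normrN => vd.
  move=> s w s01 wv; apply: dP; last by rewrite /= in_itv.
  by rewrite -ball_normE /= sub0r normrN (le_lt_trans wv).
apply: ((compact_near_coveringP _).1 (@segment_compact R 0 1) _ (nbhs (0 : V))
  (fun w (s : R) => `|f (p + s *: (z - p) + w) - f (p + s *: (z - p))| <= e)
  (nbhs_filter _)) => s.
rewrite /= in_itv/= => /cf /cvgrPdist_lt /(_ _ e20) fs.
  pose g (q : R * V) := p + q.1 *: (z - p) + q.2.
  have cg : {for (s, 0), continuous g}.
    apply: cvgD; last exact: cvg_snd.
    apply: cvgD; first exact: cvg_cst.
    by apply: cvgZr_tmp; exact: cvg_fst.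
  have cg0 : {for (s, 0), continuous (fun q : R * V => g (q.1, 0))}.
    apply: cvgD; last exact: cvg_cst.
    apply: cvgD; first exact: cvg_cst.
    by apply: cvgZr_tmp; exact: cvg_fst.
  have gs : g (s, 0) = p + s *: (z - p) by rewrite /g /= addr0.
  move: fs; rewrite -gs => fs.
  have H1 : \forall q \near ((s, 0) : R * V), `|f (g (s, 0)) - f (g q)| < e / 2.
    exact: (cg _ fs).
  have H2 : \forall q \near ((s, 0) : R * V),
    `|f (g (s, 0)) - f (g (q.1, 0))| < e / 2 by exact: (cg0 _ fs).
  suff H : \forall q \near ((s, 0) : R * V),
    `|f (p + q.1 *: (z - p) + q.2) - f (p + q.1 *: (z - p))| <= e by exact: H.
  near=> q; have H3 : `|f (g (s, 0)) - f (g q)| < e / 2 by near: q.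
  have H4 : `|f (g (s, 0)) - f (g (q.1, 0))| < e / 2 by near: q.
  (* Both values are compared with the one at the base parameter [s], each up to [e / 2]. *)
  rewrite (_ : _ - _ = (f (g (s, 0)) - f (g (q.1, 0))) - (f (g (s, 0)) - f (g q))).
    by rewrite (splitr e) (le_trans (ler_normB _ _)) // lerD // ltW.
  by rewrite opprB [RHS]addrC subrKA /g /= addr0.
Unshelve. all: by end_near. Qed.

Lemma is_derive_line f (x w : V) (t : R) : differentiable f (x + t *: w) ->
  is_derive t (1 : R) (fun t => f (x + t *: w)) ('D_w f (x + t *: w)).
Proof.
move=> df; set F := fun t => _.
have E : (fun h : R => h^-1 *: ((F \o shift t) (h *: (1 : R)) - F t)) =
    (fun h : R => h^-1 *: ((f \o shift (x + t *: w)) (h *: w) - f (x + t *: w))).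
  apply/funext => h; rewrite /F /=; congr (_ *: (f _ - _)).
  by rewrite [h *: 1]mulr1 scalerDl addrCA.
apply: DeriveDef; last by rewrite /derive E.
by rewrite /derivable E; exact: diff_derivable.
Qed.

Lemma mean_value_line f (x w : V) :
  (forall t : R, 0 <= t <= 1 -> differentiable f (x + t *: w)) ->
  exists2 t : R, 0 <= t <= 1 &
    f (x + w) - f x = \sum_i w 0 i * 'D_(e_ i) f (x + t *: w).
Proof.
move=> df; pose F (t : R) := f (x + t *: w).
have dF (t : R) : 0 <= t <= 1 -> is_derive t (1 : R) F ('D_w f (x + t *: w)).
  by move=> /df; exact: is_derive_line.
have [|||t] := @MVT_segment R F (fun t => 'D_w f (x + t *: w)) 0 1.
- exact: ler01.
- by move=> t; rewrite in_itv/= => /andP[t0 t1]; apply: dF; rewrite !ltW.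
- apply: continuous_in_subspaceT => t; rewrite inE/= in_itv/= => t01.
  by apply/differentiable_continuous/derivable1_diffP; have [] := dF t t01.
rewrite in_itv/= => t01; rewrite /F scale1r scale0r addr0 subr0 mulr1 => ->.
by exists t => //; rewrite derive_sum_coord //; exact: df.
Qed.

(** For [m = 0] and [f] a partial derivative this is a Hadamard coefficient; each differentiation in
    [z] brings out one more factor [s]. *)
Definition ray_mean (p : V) (m : nat) f (z : V) : R :=
  mean (fun s => s ^+ m * f (p + s *: (z - p))).

Section RayMean.
Variables (U : set V) (p : V).
Hypotheses (oU : open U)
  (starU : forall z (s : R), U z -> 0 <= s <= 1 -> U (p + s *: (z - p))).

Lemma ray_continuous (m : nat) f z : Ck 0 U f -> U z -> forall s : R, 0 <= s <= 1 ->
  {for s, continuous (fun s : R => s ^+ m * f (p + s *: (z - p)))}.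
Proof.
move=> cf Uz s s01; apply: cvgM.
  exact: exprn_continuous.
have cg : {for s, continuous (fun s : R => p + s *: (z - p))}.
  by apply: cvgD; [exact: cvg_cst|apply: cvgZr_tmp; exact: cvg_id].
by apply: (continuous_comp cg); exact/cf/starU.
Qed.

Lemma near_norm_le z : U z ->
  \forall v \near (0 : V), forall w, `|w| <= `|v| -> U (w + z).
Proof.
move=> Uz; have /nbhs_ballP[d /= d0 dU] : nbhs z U by exact: open_nbhs_nbhs.
apply/nbhs_ballP; exists d => //= v; rewrite -ball_normE /= sub0r normrN => vd w wv.
apply: dU; rewrite -ball_normE /= opprD addrCA subrr addr0 normrN.
exact: le_lt_trans vd.
Qed.

Let scale_norm_le (s : R) (v : V) : 0 <= s <= 1 -> `|s *: v| <= `|v|.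
Proof. by move=> /andP[s0 s1]; rewrite normrZ ger0_norm // ler_piMl. Qed.

(* The family of all ray_mean p m f is closed under differentiation: the
   derivative of ray_mean p m f along v is ray_mean p m.+1 ('D_v f). *)
Lemma Ck_ray_mean k m f : Ck k U f -> Ck k U (ray_mean p m f).
Proof.
elim: k m f => [|k IH] m f Cf.
  move=> z Uz; suff : ray_mean p m f y @[y --> z] --> ray_mean p m f z by [].
  apply/(cvgrPdist_le (FF := nbhs_filter z)) => e e0.
  suff H : \forall v \near (0 : V), `|ray_mean p m f z - ray_mean p m f (v + z)| <= e.
    have /nbhs_ballP[d /= d0 dP] := H; apply/nbhs_ballP; exists d => //= y zy.
    have := dP (y - z); rewrite subrK; apply.
    by move: zy; rewrite -!ball_normE /= sub0r opprB.
  near=> v.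
  have Uvz : U (v + z) by near: v; apply: filterS (near_norm_le Uz) => v; exact.
  have fv : forall s w, 0 <= s <= 1 -> `|w| <= `|v| ->
      `|f (p + s *: (z - p) + w) - f (p + s *: (z - p))| <= e.
    near: v; apply: segment_near_uniform => // s s01; exact/Cf/starU.
  have cz := ray_continuous (m := m) Cf Uz.
  have cvz := ray_continuous (m := m) Cf Uvz.
  rewrite /ray_mean -meanB //; apply: mean_norm_le => [s s01|s s01].
    by apply: cvgB; [exact: cz|exact: cvz].
  rewrite -mulrBr normrM distrC.
  have -> : p + s *: (v + z - p) = p + s *: (z - p) + s *: v.
    by rewrite -addrA scalerDr addrA addrAC.
  rewrite -[e]mul1r ler_pM ?fv ?scale_norm_le //.
  have /andP[s0 s1] := s01.
  by rewrite ger0_norm ?exprn_ge0 // exprn_ile1.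
have C0 : Ck 0 U f by exact: Ck_0 Cf.
have df z : U z -> differentiable f z by exact: Ck_differentiable Cf.
have Cd i : Ck k U (fun x => 'D_(e_ i) f x) by have [_ H] := Cf; exact: H.
have Cd0 i : Ck 0 U (fun x => 'D_(e_ i) f x).
  exact: Ck_0 (Cd i).
have key z : U z -> differentiable (ray_mean p m f) z /\
    forall v, 'D_v (ray_mean p m f) z =
      \sum_i v 0 i * ray_mean p m.+1 (fun x => 'D_(e_ i) f x) z.
  move=> Uz; apply: differentiable_bound => e e0.
  (* Each of the [n] partial derivatives gets a share of [e]; [n.+1] keeps the divisor positive when
     [n = 0]. *)
  have e10 : 0 < e / n.+1%:R by rewrite divr_gt0 // ltr0n.
  near=> v.
  have Uw : forall w, `|w| <= `|v| -> U (w + z) by near: v; exact: near_norm_le.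
  have fv : forall i s w, 0 <= s <= 1 -> `|w| <= `|v| ->
      `|'D_(e_ i) f (p + s *: (z - p) + w) - 'D_(e_ i) f (p + s *: (z - p))|
      <= e / n.+1%:R.
    near: v; apply: filter_forall => i.
    apply: (@segment_near_uniform (fun x => 'D_(e_ i) f x) p z _ e10) => s s01.
    exact/(Cd0 i)/starU.
  have Uvz : U (v + z) by exact: Uw.
  have cz := ray_continuous (m := m) C0 Uz.
  have cvz := ray_continuous (m := m) C0 Uvz.
  have [cD mD] := mean_sum (index_enum 'I_n) (fun i => v 0 i)
    (fun i => ray_continuous (m := m.+1) (Cd0 i) Uz).
  rewrite -mD /ray_mean -meanB // -meanB //; last first.
    by move=> s s01; apply: cvgB; [exact: cvz|exact: cz].
  apply: mean_norm_le => [s s01|s s01].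
    apply: cvgB; last exact: cD.
    by apply: cvgB; [exact: cvz|exact: cz].
  have /andP[s0 s1] := s01.
  have -> : p + s *: (v + z - p) = p + s *: (z - p) + s *: v.
    by rewrite -addrA scalerDr addrA addrAC.
  set q := p + s *: (z - p).
  (* For fixed [s], the increment of [f] along [s *: v] is a combination of partial derivatives at a
     point of that segment; the scaling of [v] yields the additional factor [s]. *)
  have [t t01|t t01 tE] := @mean_value_line f q (s *: v).
    apply: df; rewrite (_ : q + _ = p + s *: (t *: v + z - p)); last first.
      rewrite /q scalerA [t * s]mulrC -scalerA -addrA -scalerDr.
      by rewrite [z - p + _]addrC addrA.
    by apply: starU => //; apply: Uw; exact: scale_norm_le.
  rewrite -mulrBr tE mulr_sumr -sumrB.
  apply: le_trans (ler_norm_sum _ _ _) _.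
  apply: (@le_trans _ _ (\sum_(i < n) `|v| * (e / n.+1%:R))).
    apply: ler_sum => i _; rewrite mxE exprSr.
    rewrite (_ : _ - _ = (s ^+ m * s) * (v 0 i * ('D_(e_ i) f (q + t *: (s *: v)) -
      'D_(e_ i) f q))); last by ring.
    rewrite -exprSr normrM -[leRHS]mul1r ler_pM //.
      by rewrite ger0_norm ?exprn_ge0 // exprn_ile1.
    rewrite normrM ler_pM ?rV_norm_ge // fv //.
    by rewrite (le_trans (scale_norm_le _ t01)) // scale_norm_le.
  rewrite sumr_const card_ord -[_ *+ n]mulr_natr -mulrA [leRHS]mulrC ler_wpM2l //.
  rewrite mulrAC ler_pdivrMr ?ltr0n // ler_wpM2l ?(ltW e0) // ler_nat //.
split=> [z /key[]//|v].
apply: (@eq_Ck _ _ k U (\sum_i cst (v 0 i) *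
    ray_mean p m.+1 (fun x => 'D_(e_ i) f x))) => //.
  by move=> z /key[_ ->]; rewrite fct_sumE.
by apply: Ck_sum => // i; apply: CkM => //; [exact: Ck_cst|exact: IH].
Unshelve. all: by end_near. Qed.

(** The increment [f z - f p] is the integral of the derivative of [f] along the segment from [p] to
    [z], which stays in [U]; [h i] is the average of the [i]-th partial derivative. *)
Lemma hadamard f : U p -> smooth_on U f -> exists h : 'I_n -> V -> R,
  [/\ forall i, smooth_on U (h i), forall i, h i p = 'D_(e_ i) f p &
      forall z, U z -> f z - f p = \sum_i (z 0 i - p 0 i) * h i z].
Proof.
move=> Up sf; have sd i : smooth_on U (fun x => 'D_(e_ i) f x).
  by move=> k; have [_ H] := sf k.+1; exact: H.
exists (fun i => ray_mean p 0 (fun x => 'D_(e_ i) f x)); split=> [i k|i|z Uz].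
- exact: Ck_ray_mean (sd i k).
- rewrite /ray_mean -[RHS]mean_cst; apply: eq_mean => s _.
  by rewrite expr0 mul1r subrr scaler0 addr0.
- have [cD mD] := mean_sum (index_enum 'I_n) (fun i => z 0 i - p 0 i)
    (fun i => ray_continuous (m := 0) (sd i 0%N) Uz).
  pose F (s : R) := f (p + s *: (z - p)).
  rewrite -mD -[LHS](_ : F 1 - F 0 = _); last first.
    by rewrite /F scale1r scale0r addr0 subrKC.
  symmetry; apply: (@mean_derive _ F _ cD) => s s01.
  have df : differentiable f (p + s *: (z - p)).
    by apply: Ck_differentiable (sf 1%N) _; exact: starU.
  apply: is_derive_eq (is_derive_line df) _; rewrite derive_sum_coord //.
  by apply: eq_bigr => i _; rewrite !mxE expr0 mul1r.
Qed.

End RayMean.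

End Hadamard.

(** * Local frames *)

Section Frame.
Context {R : realType} {n : nat} {M : smoothManifold R n}.
Local Notation V := 'rV[R]_n.
Local Notation e_ i := (delta_mx 0 i : V).
Local Notation Fn := (cinf M).
Implicit Types (f g : Fn) (X : vfield M) (c d : chart R n M).

Lemma open_chart_image c (O : set M) : open O -> open (c @` (chart_dom c `&` O)).
Proof.
move=> oO; rewrite openE => _ [x [cx Ox] <-].
have icx : (c @` chart_dom c) (c x) by exists x.
have oI : nbhs (c x) (c @` chart_dom c).
  by apply: open_nbhs_nbhs; split=> //; exact: chart_img_open.
have iO : nbhs (c x) [set y | O (chart_inv c y)].
  apply: (chart_inv_cont icx); rewrite chart_mapK //.
  exact: open_nbhs_nbhs.
rewrite /interior/=; apply: filterS (filterI oI iO) => y [[x' cx' <-]] /=.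
by rewrite chart_mapK // => Ox'; exists x'.
Qed.

Lemma compact_norm_ball (a : V) (r : R) : 0 < r -> compact [set y | `|y - a| <= r].
Proof.
move=> r0; apply: bounded_closed_compact; last first.
  rewrite (_ : [set _ | _] = closed_ball a r); first exact: closed_ball_closed.
  rewrite closed_ballE //; apply/seteqP.
  by split=> y; rewrite /= /closed_ball_ /= distrC.
exists (r + `|a|); split; first exact: num_real.
move=> s rs y /= ya; apply: le_trans (ltW rs).
by rewrite -[y](subrK a) (le_trans (ler_normD _ _)) // lerD2r.
Qed.

Definition extend_by_zero c (h : V -> R) (x : M) : R :=
  if `[< chart_dom c x >] then h (c x) else 0.

(** The chart domain and the complement of the compact set [K] that corresponds to the ball cover
    [M]. The latter is open because [M] is Hausdorff, and the extension vanishes on it. *)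
Lemma extend_by_zero_smooth c (a : V) (r : R) (h : V -> R) : 0 < r -> atlas c ->
  [set y | `|y - a| <= r] `<=` c @` chart_dom c ->
  smooth_on setT h -> (forall y, ~ `|y - a| <= r -> h y = 0) ->
  is_smooth (extend_by_zero c h).
Proof.
move=> r0 ac aU sh h0 d ad k; apply: Ck_local => _ [x dx <-].
have [cx|ncx] := pselect (chart_dom c x).
  have oW := open_chart_image (c := d) (chart_dom_open c).
  exists (d @` (chart_dom d `&` chart_dom c)); first by exists x.
  have := Ck_comp (F := fun y => c (chart_inv d y)) oW openT (fun _ _ => I)
    (fun j => atlas_compatible ad ac j k) (sh k).
  apply: eq_Ck => // _ [x' [dx' cx'] <-] /=.
  by rewrite /extend_by_zero chart_mapK // asboolT.
pose K := chart_inv c @` [set y | `|y - a| <= r].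
have cK : closed K.
  apply: compact_closed; first exact: manifold_hausdorff.
  apply: continuous_compact; last exact: compact_norm_ball.
  apply: continuous_in_subspaceT => y; rewrite inE => /aU.
  exact: chart_inv_cont.
have oW := open_chart_image (c := d) (closed_openC cK).
exists (d @` (chart_dom d `&` ~` K)).
  exists x => //; split=> // -[y /aU[x' cx' <-]].
  by rewrite chart_mapK // => xx'; apply: ncx; rewrite -xx'.
apply: eq_Ck (Ck_cst k 0 oW) => // _ [x' [dx' Kx'] <-] /=.
rewrite /extend_by_zero chart_mapK //; case: asboolP => // cx'.
by rewrite h0 // => cx'a; apply: Kx'; exists (c x') => //; exact: chart_mapK.
Qed.

Lemma cinfDE f g x : (f + g) x = f x + g x. Proof. by []. Qed.
Lemma cinfNE f x : (- f) x = - f x. Proof. by []. Qed.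
Lemma cinfME f g x : (f * g) x = f x * g x. Proof. by []. Qed.
Lemma cinf_sumE (I : Type) (r : seq I) (F : I -> Fn) x :
  (\sum_(i <- r) F i) x = \sum_(i <- r) F i x.
Proof. by elim: r => [|i r IH]; rewrite ?big_nil ?big_cons // cinfDE IH. Qed.

Lemma cinfext f g : f =1 g -> f = g.
Proof. by move=> fg; apply/val_inj/funext. Qed.

Lemma vfield_cst X (k : R) : X (cinf_cst M k) = 0.
Proof.
have X1 : X 1 = 0.
  by apply: (addrI (X 1)); rewrite -[in RHS](mulr1 1) vfieldM !mul1r addr0.
by rewrite -[cinf_cst M k]mulr1 vfieldcZ X1 mulr0.
Qed.

Lemma derive_scaleD (f g : V -> R) (k : R) (y v : V) :
  differentiable f y -> differentiable g y ->
  'D_v (cst k * f + g) y = k * 'D_v f y + 'D_v g y.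
Proof.
move=> df dg; have dk : derivable (cst k * f) y v.
  by apply: derivableM; [exact: derivable_cst|exact: diff_derivable].
rewrite deriveD //; last exact: diff_derivable.
rewrite deriveM; [|exact: derivable_cst|exact: diff_derivable].
by rewrite derive_cst scaler0 addr0.
Qed.

(** * The coordinate frame, cut off by a bump supported in a smaller ball *)

Section ChartFrame.
Variables (c : chart R n M) (a : V) (r r' : R) (psi : V -> R).
Hypotheses (ac : atlas c) (r0 : 0 < r) (rr' : r < r').
Hypothesis aU : ball a r' `<=` c @` chart_dom c.
Hypothesis spsi : smooth_on setT psi.
Hypothesis psi0 : forall y, r <= `|y - a| -> psi y = 0.

Let B := ball a r'.

Let oB : open B. Proof. exact: ball_open. Qed.

Let in_ball y : psi y != 0 -> B y.
Proof.
move=> py; rewrite /B -ball_normE /= distrC (lt_trans _ rr') // ltNge.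
by apply: contra_neqN py; exact: psi0.
Qed.

Let ballP y : `|y - a| <= r -> B y.
Proof. by move=> ya; rewrite /B -ball_normE /= distrC (le_lt_trans ya). Qed.

Lemma cutoff_smooth (u : V -> R) : smooth_on B u ->
  is_smooth (extend_by_zero c (psi * u)).
Proof.
move=> su; apply: (extend_by_zero_smooth r0 ac).
- by move=> y /ballP /aU.
- apply: (@smooth_on_setT _ _ B [set y | `|y - a| <= r]) => //.
  + by apply: compact_closed; [exact: norm_hausdorff|exact: compact_norm_ball].
  + move=> y /= /negP; rewrite -ltNge => ya.
    by rewrite !fctE psi0 ?mul0r // ltW.
  + move=> k; apply: CkM => //; apply: Ck_subset (spsi k).
    exact: subsetT.
- by move=> y /negP; rewrite -ltNge => ya; rewrite !fctE psi0 ?mul0r // ltW.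
Qed.

Definition cutoff (u : V -> R) (su : smooth_on B u) : Fn :=
  Cinf (asboolT (cutoff_smooth su) : _ \in @smooth_pred _ _ M).

Lemma cutoffE u (su : smooth_on B u) x : cutoff su x =
  if `[< chart_dom c x >] then psi (c x) * u (c x) else 0.
Proof. by []. Qed.

Let local_smooth f : smooth_on B (f \o chart_inv c).
Proof.
move=> k; apply: Ck_subset aU _.
by have /asboolP sf := valP f; exact: sf.
Qed.

Let partial_smooth f i : smooth_on B (fun y => 'D_(e_ i) (f \o chart_inv c) y).
Proof. by move=> k; have [_ H] := local_smooth f k.+1; exact: H. Qed.

Lemma chart_field_subproof i :
  (fun f => cutoff (partial_smooth f i) : Fn^o) \in @derivation_pred _ _ M.
Proof.
have df f y : B y -> differentiable (f \o chart_inv c) y.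
  exact: Ck_differentiable (local_smooth f 1%N).
apply/asboolP; split=> [k f g|f g]; apply: cinfext => x;
  rewrite !(cinfDE, cinfME) !cutoffE; case: asboolP => [cx|_];
  rewrite ?(mulr0, addr0) //.
- have [->|/in_ball Bx] := eqVneq (psi (c x)) 0; first by rewrite !mul0r mulr0 addr0.
  rewrite (@derive_scaleD (f \o chart_inv c) (g \o chart_inv c)); [|exact: df..].
  by rewrite mulrDr mulrCA.
- have [->|/in_ball Bx] := eqVneq (psi (c x)) 0; first by rewrite !mul0r !mulr0 addr0.
  rewrite (@deriveM _ _ (f \o chart_inv c) (g \o chart_inv c)); last first.
  + exact/diff_derivable/df.
  + exact/diff_derivable/df.
  by rewrite /= chart_mapK // mulrDr ![psi _ * (_ *: _)]mulrCA.
Qed.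
Definition chart_field i : vfield M := VField (chart_field_subproof i).

Let chart_fieldE i f x : chart_field i f x = if `[< chart_dom c x >] then
  psi (c x) * 'D_(e_ i) (f \o chart_inv c) (c x) else 0.
Proof. by []. Qed.

Definition chart_bump : Fn := cutoff (fun k => Ck_cst k 1 oB).
Definition chart_coord i : Fn := cutoff (fun k => Ck_coord k i oB).
Local Notation rho := chart_bump.
Local Notation coord := chart_coord.

Lemma chart_bumpE x : rho x = if `[< chart_dom c x >] then psi (c x) else 0.
Proof. by rewrite cutoffE /= mulr1. Qed.

(* X is applied, at the point x, to Hadamard's formula
   rho^2 (g - g(x)) = \sum_i (coord_i - x_i rho) H_i, an identity between global
   functions. *)
Lemma chart_frame X : (rho * rho * rho) *: X =
  \sum_i (rho * X (coord i) - coord i * X rho) *: chart_field i.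
Proof.
apply: vfieldext => g; apply: cinfext => x.
rewrite vfield_sumE cinf_sumE vfieldZE !cinfME.
(* Where [rho] vanishes, so do the fields [chart_field i]. *)
have [rx0|rx] := eqVneq (rho x) 0.
  rewrite rx0 !mul0r big1 // => i _.
  rewrite vfieldZE cinfME chart_fieldE; move: rx0; rewrite chart_bumpE.
  by case: asboolP => _ => [->|_]; rewrite ?mul0r mulr0.
have cx : chart_dom c x.
  by move: rx; rewrite chart_bumpE; case: asboolP => //; rewrite eqxx.
have rxE : rho x = psi (c x) by rewrite chart_bumpE asboolT.
have Bx : B (c x) by apply: in_ball; rewrite -rxE.
(* A ball is convex, hence star-shaped about [c x], as Hadamard's lemma requires. *)
have starB (z : V) (s : R) : B z -> 0 <= s <= 1 -> B (c x + s *: (z - c x)).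
  move: (Bx); rewrite /B -!ball_normE /= => Bx' Bz /andP[s0 s1].
  rewrite (_ : _ - _ = (1 - s) *: (a - c x) + s *: (a - z)); last first.
    by apply/rowP => j; rewrite !mxE; ring.
  apply: (@le_lt_trans _ _ (Num.max `|a - c x| `|a - z|)); last by rewrite gt_max Bx'.
  set m := Num.max _ _; apply: le_trans (ler_normD _ _) _.
  rewrite !normrZ !ger0_norm ?subr_ge0 //.
  rewrite [leRHS](_ : _ = (1 - s) * m + s * m); last by ring.
  by rewrite lerD // ler_wpM2l ?subr_ge0 // le_max lexx ?orbT.
have [h [sh hx hE]] := hadamard oB starB Bx (local_smooth g).
pose H i : Fn := cutoff (sh i).
have E : rho * rho * (g - cinf_cst M (g x)) =
    \sum_i (coord i - cinf_cst M (c x 0 i) * rho) * H i.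
  apply: cinfext => z; rewrite cinf_sumE !cinfME chart_bumpE.
  under eq_bigr do rewrite cinfME cinfDE cinfNE cinfME chart_bumpE.
  case: asboolP => [cz|ncz]; last first.
    by rewrite !mul0r big1 // => i _; rewrite /H cutoffE asboolF // mulr0.
  under eq_bigr do rewrite !cutoffE asboolT //.
  have [->|/in_ball Bz] := eqVneq (psi (c z)) 0.
    by rewrite !mul0r big1 // => i _; rewrite !mul0r !mulr0.
  have := hE _ Bz; rewrite /= !chart_mapK // => gE.
  rewrite [X in _ * X = _](_ : _ = g z - g x) // gE mulr_sumr; apply: eq_bigr => i _.
  ring.
(* The factors [g - g(x)] and [coord i - x_i rho] vanish at [x], so only the terms where [X] hits
   them survive. *)
have := congr1 (fun f : Fn => X f x) E.
rewrite vfieldM vfield_sum cinfDE cinf_sumE !cinfME vfieldD vfieldN vfield_cst.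
rewrite subr0 cinfDE cinfNE subrr mul0r addr0 => XE.
(* The third factor [rho] turns [x_i rho(x)] into [coord i x], which makes the coefficients
   independent of the chosen point. *)
rewrite [rho x * rho x * rho x]mulrC -mulrA XE mulr_sumr; apply: eq_bigr => i _.
rewrite vfieldM cinfDE !cinfME cinfDE cinfNE cinfME.
rewrite vfieldD vfieldN vfieldcZ !cinfDE !cinfNE !cinfME.
have -> : coord i x = rho x * c x 0 i by rewrite rxE cutoffE asboolT.
rewrite -[\val _]/(chart_field i : _ -> _) (_ : chart_field i g x = H i x);
  last by rewrite chart_fieldE cutoffE hx.
rewrite /=; ring.
Qed.

End ChartFrame.

Lemma local_frame (x : M) : exists2 h : Fn, h x != 0 &
  exists (w : 'I_n -> oneform M) (E : 'I_n -> vfield M),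
    forall X, h *: X = \sum_i w i X *: E i.
Proof.
have [c ac cx] := atlas_cover x.
have /nbhs_ballP[r' /= r'0 aU] : nbhs (c x) (c @` chart_dom c).
  by apply: open_nbhs_nbhs; split; [exact: chart_img_open|exists x].
have r0 : 0 < r' / 2 by rewrite divr_gt0.
have rr' : r' / 2 < r' by rewrite ltr_pdivrMr // ltr_pMr // ltr1n.
have [psi [spsi px psi0]] := smooth_bump (c x) r0.
pose rho := chart_bump ac r0 rr' aU spsi psi0.
pose coord := chart_coord ac r0 rr' aU spsi psi0.
exists (rho * rho * rho).
  by rewrite !cinfME !mulf_neq0 // chart_bumpE asboolT.
(* By the quotient rule this is [rho^2] times the differential of the [i]-th coordinate
   [coord i / rho]. *)
exists (fun i => rho *: differential (coord i) - coord i *: differential rho).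
exists (chart_field ac r0 rr' aU spsi psi0) => X.
exact: chart_frame.
Qed.

End Frame.

(** * Uniqueness of the bracket and Killing tensors *)

Section Uniqueness.
Context {R : realType} {n : nat} {M : smoothManifold R n}.
Local Notation Fn := (cinf M).
Local Notation X1 := (vfield M).
Local Notation O1 := (oneform M).
Implicit Types (f g h : Fn) (X Y Z : X1) (a b : O1) (P Q S : symt O1).

Lemma cinf_half f : cinf_cst M (2^-1) * (f + f) = f.
Proof.
apply/val_inj/funext => x; rewrite /= /GRing.mul/=.
rewrite -[RHS](mulrK (x := 2)) ?unitfE ?pnatr_eq0 //.
by rewrite mulr_natr mulr2n mulrC.
Qed.

Lemma homog_symprod r s P Q : homog r P -> homog s Q -> homog (r + s) (symprod P Q).
Proof.
move=> rP sQ l lrs; rewrite symprodE.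
apply: (sum_splits0 (H := fun u v => P u * Q v)) => u v uv.
have [ur|ur] := eqVneq (size u) r; last by rewrite rP ?mul0r.
by rewrite sQ ?mulr0 //; apply: contra_neq lrs => vs; rewrite -uv ur vs.
Qed.

Lemma symt_sum P (I : Type) (r : seq I) (c : I -> Fn) (a : I -> O1) s :
  P (\sum_(i <- r) c i *: a i :: s) = \sum_(i <- r) c i * P (a i :: s).
Proof.
elim: r => [|i r IH]; first by rewrite !big_nil symt_cons0.
by rewrite !big_cons symt_linear IH.
Qed.

Lemma oneform_0 a : a 0 = 0.
Proof. by have := oneformP a (-1) 0 0; rewrite scaler0 addr0 scaleN1r addNr. Qed.

Lemma oneform_sum a (I : Type) (r : seq I) (c : I -> Fn) (E : I -> X1) :
  a (\sum_(i <- r) c i *: E i) = \sum_(i <- r) c i * a (E i).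
Proof.
elim: r => [|i r IH]; first by rewrite !big_nil oneform_0.
by rewrite !big_cons oneformP IH.
Qed.

Lemma symt_sumE (I : Type) (r : seq I) (F : I -> symt O1) s :
  (\sum_(i <- r) F i) s = \sum_(i <- r) F i s.
Proof. by elim: r => [|i r IH]; rewrite ?big_nil ?big_cons // symtD IH. Qed.

(** Dually, [h *: a] is the sum of the [a (E i) *: w i], which is inserted in both slots of [P]. The
    factor 1/2 makes up for the two terms of the product of [E i] and [E j]. *)
Lemma frame_decomposition P h (w : 'I_n -> O1) (E : 'I_n -> X1) : homog 2 P ->
  (forall X, h *: X = \sum_i w i X *: E i) ->
  (h * h) *: P = \sum_i \sum_j
    symprod (symt0 (cinf_cst M (2^-1) * P [:: w i; w j]))
            (symprod (symt1 (E i)) (symt1 (E j))).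
Proof.
move=> hP hE.
have ha a : h *: a = \sum_i a (E i) *: w i.
  apply: oneformext => X.
  have -> : (\sum_i a (E i) *: w i) X = \sum_i a (E i) * w i X.
    by elim/big_rec2: _ => // i y1 y2 _; rewrite oneformDE => ->.
  have := oneformP a h X 0; rewrite addr0 hE oneform_sum oneform_0 addr0 => hX.
  rewrite oneformZE -[LHS]hX.
  by apply: eq_bigr => i _; rewrite mulrC.
apply: symtext => s; rewrite symtZ symt_sumE.
have [|s2] := eqVneq (size s) 2%N; last first.
  rewrite hP // mulr0 big1 // => i _; rewrite symt_sumE big1 // => j _.
  rewrite symprod_symt0 symtZ (homog_symprod (homog_symt1 _) (homog_symt1 _)) //.
  by rewrite mulr0.
case: s => [|a [|b [|? ?]]] // _.
have -> : h * h * P [:: a; b] = P [:: h *: a; h *: b].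
  by rewrite symt_scale (symt_swap P a (h *: b)) symt_scale (symt_swap P b) mulrA.
rewrite !ha symt_sum.
under [RHS]eq_bigr do rewrite symt_sumE.
under [RHS]eq_bigr do under eq_bigr do rewrite symprod_symt0 symtZ symprodE
  !big_cons big_nil /= !(mul0r, mulr0, addr0, add0r) mulrDr.
under [RHS]eq_bigr do rewrite big_split.
rewrite big_split /= [X in _ = _ + X]exchange_big /= -big_split.
apply: eq_bigr => i _; rewrite symt_swap symt_sum mulr_sumr -big_split.
apply: eq_bigr => j _; rewrite /= (symt_swap _ (w j)).
rewrite -[LHS]cinf_half.
have e (c x y p : Fn) : c * (x * (y * p) + x * (y * p)) =
  c * p * (x * y) + c * p * (y * x) by ring.
exact: e.
Qed.

(** * Two brackets for the same connection agree in degree 2 *)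

Section Difference.
Variables (D : connection M) (br br' : symt O1 -> symt O1 -> symt O1).
Hypotheses (brP : is_schouten D br) (brP' : is_schouten D br').
Let E P Q := br P Q - br' P Q.

Lemma schouten_additive_r (b : symt O1 -> symt O1 -> symt O1) P Q S :
  is_schouten D b -> b P (Q + S) = b P Q + b P S.
Proof.
move=> bP; rewrite !(schouten_comm bP P).
by have := schouten_linear bP 1 Q S P; rewrite cinf_cst1 !scale1r.
Qed.

Let E_C P Q : E P Q = E Q P.
Proof. by rewrite /E (schouten_comm brP) (schouten_comm brP'). Qed.

Let E_D P Q S : E P (Q + S) = E P Q + E P S.
Proof.
rewrite /E (schouten_additive_r _ _ _ brP) (schouten_additive_r _ _ _ brP').
by rewrite opprD addrACA.
Qed.

Let E_0 P : E P 0 = 0.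
Proof. by apply: (addrI (E P 0)); rewrite -E_D !addr0. Qed.

Let E_sum P (I : Type) (r : seq I) (F : I -> symt O1) :
  (forall i, E P (F i) = 0) -> E P (\sum_(i <- r) F i) = 0.
Proof.
move=> F0; elim: r => [|i r IH]; first by rewrite big_nil E_0.
by rewrite big_cons E_D F0 IH addr0.
Qed.

Let E_M r P Q S : homog r P ->
  E P (symprod Q S) = symprod (E P Q) S + symprod Q (E P S).
Proof.
move=> rP; rewrite /E (schouten_derivation brP _ _ rP).
rewrite (schouten_derivation brP' _ _ rP); apply: symtext => s.
rewrite !(symtD, symtN) !symprodE opprD addrACA -!sumrB.
by congr (_ + _); apply: eq_bigr => p _; rewrite symtD symtN ?mulrBl ?mulrBr.
Qed.

Let symprod0l P : symprod 0 P = 0.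
Proof. by apply: symtext => s; rewrite symprodE big1 // => p _; rewrite mul0r. Qed.
Let symprod0r P : symprod P 0 = 0.
Proof. by apply: symtext => s; rewrite symprodE big1 // => p _; rewrite mulr0. Qed.

(** The derivation [E P] kills the frame decomposition of [h^2 Q], and it commutes with
    multiplication by [h^2] since it kills functions. Dividing by [h(x)^2] gives the vanishing at
    [x]. *)
Let E_local r P Q : homog r P -> (forall X, E P (symt1 X) = 0) ->
  (forall f, E P (symt0 f) = 0) -> homog 2 Q -> E P Q = 0.
Proof.
move=> rP P1 P0 hQ; apply: symtext => s; apply/val_inj/funext => x.
have [h hx [w [e he]]] := local_frame x.
have : E P ((h * h) *: Q) = 0.
  rewrite (frame_decomposition hQ he).
  apply: E_sum => i; apply: E_sum => j.
  rewrite (E_M _ _ rP) P0 symprod0l add0r (E_M _ _ rP) !P1.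
  by rewrite symprod0l symprod0r addr0 symprod0r.
rewrite -symprod_symt0 (E_M _ _ rP) P0 symprod0l add0r symprod_symt0.
move=> /(congr1 (fun F : symt O1 => F s)); rewrite symtZ.
move=> /(congr1 (fun f : Fn => f x)).
rewrite /= /GRing.mul /= /GRing.mul/= => /eqP; rewrite !mulf_eq0 (negbTE hx) /=.
by move=> /eqP.
Qed.

Lemma schouten_unique2 P Q : homog 2 P -> homog 2 Q -> br P Q = br' P Q.
Proof.
move=> hP hQ; apply/eqP; rewrite -subr_eq0; apply/eqP.
have E11 X Y : E (symt1 X) (symt1 Y) = 0.
  by rewrite /E (schouten_vfield brP) (schouten_vfield brP') subrr.
have E10 X f : E (symt1 X) (symt0 f) = 0.
  by rewrite /E (schouten_fun brP) (schouten_fun brP') subrr.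
(* The axioms only constrain this case through [schouten_degree], as the degree would be -1. *)
have E00 f g : E (symt0 f) (symt0 g) = 0.
  apply: symtext => l; rewrite symtD symtN.
  by rewrite (schouten_degree brP (@homog_symt0 _ _ _ f) (@homog_symt0 _ _ _ g))
    // (schouten_degree brP' (@homog_symt0 _ _ _ f) (@homog_symt0 _ _ _ g))
    // subrr.
(* [E_local] is used three times: with a vector field or a function in the first argument, and then,
   by symmetry, with [P] itself. *)
apply: (E_local hP) => // [X|f]; rewrite E_C.
  exact: (E_local (@homog_symt1 _ _ _ X)).
by apply: (E_local (@homog_symt0 _ _ _ f)) => // X; rewrite E_C.
Qed.

End Difference.

(** By uniqueness any bracket of [th] with itself is that of [schouten D], which is twice the half
    bracket. *)
Lemma schouten_self_zeroP (D : connection M) th : homog 2 th ->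
  schouten_self_zero D th <-> half_bracket D th th = 0.
Proof.
move=> hth; split=> [[br brP]|th0].
  rewrite (schouten_unique2 brP (schoutenP D)) // => th0; apply: symtext => s.
  by rewrite -[LHS]cinf_half -symtD [_ + _]th0 mulr0.
by exists (schouten D); [exact: schoutenP|rewrite /schouten th0 addr0].
Qed.

(** * The self-bracket seen through the musical isomorphism *)

Section Musical.
Variables (D : connection M) (th : symt O1) (K : symt X1) (S : O1 -> X1).
Hypotheses (hth : homog 2 th) (thS : is_musical th S).
Hypotheses (SK : cancel S (flat K)) (KS : cancel (flat K) S).

Lemma cov_deriv3 (H : symt X1) X Y Z : cov_deriv D H [:: X; Y; Z] =
  X (H [:: Y; Z]) - (H [:: D X Y; Z] + H [:: Y; D X Z]) :> Fn.
Proof. by rewrite /cov_deriv /= !big_ord_recl big_ord0 /= addr0. Qed.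

Lemma interior_flat X : interior_vfield th [:: flat K X] = X.
Proof. by apply: vfieldext => f; rewrite /= symt_swap -thS KS. Qed.

(** The minus sign of the derivative of an inverse: [X (K [:: Y; Z])] occurs once positively, and
    once negatively in each of the two insertions. *)
Lemma cov_multivector_flat X Y Z :
  cov_multivector D X th [:: flat K Y; flat K Z] = - cov_deriv D K [:: X; Y; Z].
Proof.
rewrite cov_deriv3 /cov_multivector /= !big_cons big_nil /=.
rewrite !(addr0, add0r) (symt_swap th (cov_oneform _ _ (flat K Y))).
rewrite (symt_swap th (cov_oneform _ _ (flat K Z))) -!thS !KS /=.
rewrite (symt_swap K Z Y) (symt_swap K Z).
have e (x y z : Fn) : x - (x - y + (x - z)) = - (x - (z + y)) by ring.
exact: e.
Qed.

Lemma half_bracket_flat X Y Z :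
  half_bracket D th th [:: flat K X; flat K Y; flat K Z] =
  - (cov_deriv D K [:: X; Y; Z] + cov_deriv D K [:: Y; Z; X] +
     cov_deriv D K [:: Z; X; Y]).
Proof.
(* As [th] has degree 2, only the three splittings with a singleton first part remain; they give the
   three cyclic terms. *)
have c0 s : size s != 1%N -> interior_vfield th s = 0.
  move=> s1; apply: interior_size0 => t tE; apply: hth.
  by rewrite tE.
rewrite half_bracketE [splits _]/= !big_cons big_nil ![(_, _).1]/= ![(_, _).2]/=.
rewrite !interior_flat.
rewrite !c0 // !cov_multivector_0 !(addr0, add0r) !cov_multivector_flat.
rewrite !cov_deriv3 (symt_swap K X Z) (symt_swap K X) (symt_swap K _ Z).
rewrite (symt_swap K (D Y X)) [K [:: Z; D Y X] + _ : Fn]addrC.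
by rewrite -!opprD addrA.
Qed.

Lemma killing_half_bracketP : homog 2 K ->
  killing 2 D K <-> half_bracket D th th = 0.
Proof.
move=> hK; rewrite killing2P; split=> [[_ K0]|th0].
  apply: symtext => s; have [|s3] := eqVneq (size s) 3; last first.
    by rewrite (half_bracket_homog D hth hth).
  case: s => [|a [|b [|c [|? ?]]]] // _.
  (* Every 1-form is in the image of [flat K]. *)
  by rewrite -(SK a) -(SK b) -(SK c) half_bracket_flat K0 oppr0.
by split=> // X Y Z; apply: oppr_inj; rewrite -half_bracket_flat th0 oppr0.
Qed.

End Musical.

(** * Inversion of symmetric bivector fields and forms *)

Lemma is_musical_unique th (S S' : O1 -> X1) :
  is_musical th S -> is_musical th S' -> S = S'.
Proof.
(* Exact 1-forms separate vector fields. *)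
move=> thS thS'; apply/funext => a; apply: vfieldext => f.
by have := thS a (differential f); rewrite -thS'.
Qed.

Lemma is_biv_inv_unique th (K K' : symt X1) :
  is_biv_inv th K -> is_biv_inv th K' -> K = K'.
Proof.
move=> [hK [S thS [SK KS]]] [hK' [S' thS' [SK' KS']]].
move: SK' KS'; rewrite (is_musical_unique thS' thS) => SK' KS'.
apply: symtext => s; have [|s2] := eqVneq (size s) 2%N; last by rewrite hK ?hK'.
case: s => [|X [|Y [|? ?]]] // _.
have : flat K X = flat K' X by rewrite -{1}(KS' X) SK.
by move=> /(congr1 (fun a : O1 => a Y)).
Qed.

Lemma is_biv_inv_inj th th' (K : symt X1) : homog 2 th -> homog 2 th' ->
  is_biv_inv th K -> is_biv_inv th' K -> th = th'.
Proof.
move=> hth hth' [_ [S thS [SK KS]]] [_ [S' thS' [SK' KS']]].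
apply: symtext => s; have [|s2] := eqVneq (size s) 2%N; last by rewrite hth ?hth'.
case: s => [|a [|b [|? ?]]] // _.
by rewrite -thS -thS' -{1}(SK' a) KS.
Qed.

Lemma biv_of_form (K : symt X1) : homog 2 K -> nondegenerate_form K ->
  exists th, [/\ homog 2 th, nondegenerate_biv th & is_biv_inv th K].
Proof.
move=> hK [S KS SK].
(* The symmetry of [K] passes to its inverse. *)
have SC a b : b (S a) = a (S b).
  by rewrite -{1}(SK b) -{2}(SK a) /= symt_swap.
have thP : (fun s : seq O1 => if s is [:: a; b] then b (S a) else 0 : Fn^o)
    \in symt_pred O1.
  apply/asboolP; split=> [s t st|f a b s|]; last by exists 2%N => -[|? [|? []]].
  - have := perm_size st.
    case: s t st => [|a [|b [|? ?]]] [|c [|d [|? ?]]] // st _.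
    have := perm_mem st c; rewrite !inE eqxx /= => /orP[] /eqP cE; subst c.
      move: st; rewrite perm_cons => /perm_mem/(_ b).
      by rewrite !inE eqxx => /esym/eqP ->.
    move: st; rewrite (perm_catC [:: a] [:: b]) perm_cons => /perm_mem/(_ a).
    by rewrite !inE eqxx => /esym/eqP <-; exact: SC.
  - case: s => [|c [|? ?]]; rewrite ?mulr0 ?addr0 //.
    (* Once [S] is moved onto [c], linearity holds by the definition of the module structure on
       1-forms. *)
    by rewrite !(SC _ c).
exists (Symt thP); split; first by move=> [|? [|? [|? ?]]].
- by exists S => //; exists (flat K).
- by split=> //; exists S.
Qed.

End Uniqueness.

Theorem proposition3p11 (R : realType) (n : nat) (M : smoothManifold R n) :
  set_bij
    [set p : symt (oneform M) * connection M |
       nondeg_symmetric_poisson p.1 p.2]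
    [set q : symt (vfield M) * connection M |
       nondeg_killing2 q.1 q.2]
    (fun p : symt (oneform M) * connection M => (biv_inv p.1, p.2)).
Proof.
split.
(* The three goals are that the map lands in the Killing pairs, its injectivity and its
   surjectivity. *)
- move=> [th D] [[/= hth tD /(schouten_self_zeroP _ hth) th0] nth].
  have [hK [S thS [SK KS]]] := biv_invP nth.
  split=> //=; last by exists S.
  exact/(killing_half_bracketP D hth thS SK KS hK).
- move=> [th D] [th' D'] /[!inE] -[[/= hth _ _] nth] [[/= hth' _ _] nth'] [KK' ->].
  congr (_, _); apply: (is_biv_inv_inj hth hth' (biv_invP nth)).
  by rewrite KK'; exact: biv_invP.
- move=> [K D] [/= tD kK nK]; have [hK _] := kK.
  have [th [hth nth thK]] := biv_of_form hK nK.
  (* [biv_inv] is given by choice, so uniqueness of the inverse is what identifies it with [K]. *)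
  have KE : biv_inv th = K := is_biv_inv_unique (biv_invP nth) thK.
  exists (th, D); last by rewrite /= KE.
  split=> //; split=> //=; apply/schouten_self_zeroP => //.
  have [_ [S thS [SK KS]]] := thK.
  exact/(killing_half_bracketP D hth thS SK KS hK).
Qed.
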